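(* When $\lambda\ge5.1\log2$, the ABC estimator $\hat f_{\hat J}$ simultaneously has the following properties. (i) For $\mathcal{F}=\mathcal{F}_q(t_n;M_n)$ with $0<q\le1$, or $\mathcal{F}=\mathcal{F}_0(k_n;M_n)$ with $1\le k_n\le M_n$, or $\mathcal{F}=\mathcal{F}_q(t_n;M_n)\cap\mathcal{F}_0(k_n;M_n)$ with $0<q\le1$ and $1\le k_n\le M_n$, $$\sup_{f_0\in\mathcal{F}}E(ASE(\hat f_{\hat J}))\le B\,\Phi^{\mathcal{F}},$$ where the constant $B$ depends only on $q$ and $\lambda$ for the first and third cases of $\mathcal{F}$, and depends only on $\lambda$ for the second case. (ii) In general, for an arbitrary $f_0^n$, $$E(ASE(\hat f_{\hat J}))\le B\Bigl(\|\bar f_{J_{M_n}}-f_0^n\|_n^2+\Bigl[\inf_{J_m:1\le m<M_n}\Bigl(\|\bar f_{J_m}-\bar f_{J_{M_n}}\|_n^2+\frac{\sigma^2r_{J_m}}{n}+\frac{\sigma^2\log(M_n\wedge n)}{n}+\frac{\sigma^2\log\binom{M_n}{m}}{n}\Bigr)\wedge\frac{\sigma^2r_{M_n}}{n}\Bigr]\Bigr)\wedge B\Bigl(\Bigl(\|\bar f_{J_0}-f_0^n\|_n^2+\frac{\sigma^2}{n}\Bigr)\wedge\sigma^2\Bigr),$$ where the constant $B$ depends only on $\lambda$.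
   Context: FIXED DESIGN. $n\ge2$, $M_n\ge2$. $Y_i=f_0(\mathbf{x}_i)+\varepsilon_i$, $i=1,\ldots,n$, with fixed $\mathbf{x}_i=(x_{i,1},\ldots,x_{i,M_n})'\in\mathbb{R}^{M_n}$, $\varepsilon_i$ i.i.d. $N(0,\sigma^2)$, $\sigma>0$ known, and $\max_{1\le j\le M_n}\sum_{i=1}^nx_{i,j}^2/n\le1$. $f_0^n=(f_0(\mathbf{x}_1),\ldots,f_0(\mathbf{x}_n))'$; $\|f\|_n^2=\frac1n\sum_if^2(\mathbf{x}_i)$ (also used for vectors in $\mathbb{R}^n$, $\|v\|_n^2=\frac1n\sum_iv_i^2$); $ASE(\hat f)=\|\hat f-f_0\|_n^2$. $f_\theta(\mathbf{x})=\sum_j\theta_jx_j$, $\|\theta\|_0$ is the number of nonzero components, $\|\theta\|_q=(\sum|\theta_j|^q)^{1/q}$; $\mathcal{F}_q(t_n;M_n)=\{f_\theta:\|\theta\|_q\le t_n\}$ ($t_n>0$), $\mathcal{F}_0(k_n;M_n)=\{f_\theta:\|\theta\|_0\le k_n\}$. MODELS. A model $J_m\subset\{1,\ldots,M_n\}$ has size $m$; $r_{J_m}$ is the rank of its design matrix; $\hat Y_{J}$ (entries $\hat Y_{i,J}$) is the projection of $Y=(Y_1,\ldots,Y_n)'$ onto the column span of the design matrix of $J$, and $\bar f_J$ the projection of $f_0^n$ onto the same space. $J_{M_n}$ is the full model with rank $r_{M_n}\ge1$. $J_0$ is the null model containing only the intercept ($\hat Y_{J_0}$ has all entries $\bar Y=\sum_iY_i/n$).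 $\bar J$ is the full projection model (projection matrix $I_{n\times n}$, $\hat Y_{\bar J}=Y$). ABC CRITERION. $ABC(J_m)=\sum_i(Y_i-\hat Y_{i,J_m})^2+2r_{J_m}\sigma^2+\lambda\sigma^2C_{J_m}$; $ABC(\bar J)=2n\sigma^2+\lambda\sigma^2C_{\bar J}$; $ABC(J_0)=\sum_i(Y_i-\bar Y)^2+2\sigma^2+\lambda\sigma^2C_{J_0}$. Here $\lambda$ is a pure constant. The candidate set $\Gamma_n$ consists of all subset models $J_m$ with $1\le m\le(M_n-1)\wedge n$, the full model $J_{M_n}$, $J_0$ and $\bar J$, with complexities $C_{J_m}=-\log0.85+\log((M_n-1)\wedge n)+\log\binom{M_n}{m}$ for $m<M_n$, and $C_{J_{M_n}}=C_{J_0}=C_{\bar J}=-\log0.05$. $\hat J=\arg\min_{J\in\Gamma_n}ABC(J)$ and $\hat f_{\hat J}$ is the fitted value $\hat Y_{\hat J}$. RATES. $\tau=\sigma^{-2}$; $m^*=\lceil(nt_n^2\tau)^{q/2}\rceil\wedge M_n\wedge n$; $m_*=m^*$ if $m^*=M_n\wedge n$, otherwise $m_*=\lceil m^*/(1+\log(M_n/m^* ))^{q/2}\rceil$. $$\Phi^{\mathcal{F}_q(t_n;M_n)}=\begin{cases}\frac{\sigma^2r_{M_n}}{n}&\text{if }m_*=M_n\wedge n,\\ \sigma^{2-q}t_n^q\Bigl(\frac{1+\log\frac{M_n}{(nt_n^2\tau)^{q/2}}}{n}\Bigr)^{1-q/2}\wedge\frac{\sigma^2r_{M_n}}{n}&\text{if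 }1<m_*<M_n\wedge n,\\ (t_n^2\vee\frac{\sigma^2}{n})\wedge\frac{\sigma^2r_{M_n}}{n}&\text{if }m_*=1,\end{cases}$$ $\Phi^{\mathcal{F}_0(k_n;M_n)}=\frac{\sigma^2k_n(1+\log(M_n/k_n))}{n}\wedge\frac{\sigma^2r_{M_n}}{n}$, $\Phi^{\mathcal{F}_q(t_n;M_n)\cap\mathcal{F}_0(k_n;M_n)}=\Phi^{\mathcal{F}_q(t_n;M_n)}\wedge\Phi^{\mathcal{F}_0(k_n;M_n)}$. *)

(* Defs.v *)
From HB Require Import structures.
From mathcomp Require Import all_boot all_order all_algebra.
From mathcomp Require Import all_classical all_reals all_analysis.

Set Implicit Arguments.
Unset Strict Implicit.
Unset Printing Implicit Defensive.

Import Order.TTheory GRing.Theory Num.Theory.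
Import numFieldNormedType.Exports.

Local Open Scope classical_set_scope.
Local Open Scope ring_scope.

(* Elements of R^n (data, mean vectors, fitted values) are row
   vectors 'rV[R]_n; the design points x_i are the rows of X : 'M[R]_(n, M). *)

Section LinearClasses.
Context {R : realType} {M : nat}.
Implicit Types (theta x : 'rV[R]_M).

Definition f_lin theta : 'rV[R]_M -> R :=
  fun x => \sum_(j < M) theta ord0 j * x ord0 j.

Definition norm0 theta : nat := #|[set j : 'I_M | theta ord0 j != 0]%SET|.

Definition normq (q : R) theta : R :=
  (\sum_(j < M) `|theta ord0 j| `^ q) `^ (q^-1).

Definition Fq (q t : R) : set ('rV[R]_M -> R) :=
  [set f_lin theta | theta in [set theta | normq q theta <= t]].

Definition F0 (k : nat) : set ('rV[R]_M -> R) :=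
  [set f_lin theta | theta in [set theta | (norm0 theta <= k)%N]].

End LinearClasses.

Definition normn2 {R : realType} {n : nat} (v : 'rV[R]_n) : R :=
  n%:R^-1 * \sum_(i < n) v ord0 i ^+ 2.

Definition eval_design {R : realType} {n M : nat} (X : 'M[R]_(n, M))
  (f : 'rV[R]_M -> R) : 'rV[R]_n := \row_(i < n) f (row i X).

(* Matrix, acting on row vectors from the right, of the projection onto the
   column span of V along kermx V, i.e. along the set of the u with u *m V = 0,
   which is the orthogonal complement of that span. *)
Definition colproj {R : realType} {n p : nat} (V : 'M[R]_(n, p)) : 'M[R]_n :=
  proj_mx <<V^T>>%MS (kermx V).

Section OrthogonalProjection.
Context {R : realType} {n p : nat}.
Variable V : 'M[R]_(n, p).

Let cap0 : (<<V^T>> :&: kermx V = 0)%MS.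
Proof.
apply/eqP/rowV0P => v; rewrite sub_capmx genmxE => /andP[/submxP[w vw]].
move/sub_kermxP => vV.
have vv : \sum_i v ord0 i ^+ 2 = 0.
  transitivity ((v *m v^T) ord0 ord0).
    by rewrite [RHS]mxE; apply: eq_bigr => i _; rewrite mxE expr2.
  by rewrite {2}vw trmx_mul trmxK mulmxA vV mul0mx mxE.
apply/rowP => i; rewrite [RHS]mxE; apply/eqP; rewrite -sqrf_eq0; apply/eqP.
by apply: (psumr_eq0P _ vv) => [k _|]; first exact: sqr_ge0.
Qed.

Lemma colproj_sub (y : 'rV[R]_n) : (y *m colproj V <= V^T)%MS.
Proof. by rewrite (submx_trans (proj_mx_sub _ _ _))// genmxE. Qed.

Lemma colproj_orth (y : 'rV[R]_n) : (y - y *m colproj V) *m V = 0.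
Proof.
apply/sub_kermxP/proj_mx_compl_sub; apply: submx_full.
rewrite /row_full eqn_leq rank_leq_col/=.
have /eqP := mxrank_sum_cap <<V^T>>%MS (kermx V).
rewrite cap0 mxrank0 addn0 genmxE mxrank_tr mxrank_ker => /eqP ->.
by rewrite subnKC// rank_leq_row.
Qed.

End OrthogonalProjection.

(* The last two are the intercept-only model, and the full projection model
   whose fitted value is the data itself. *)
Inductive model (M : nat) : Type :=
  | Subset of {set 'I_M}
  | Intercept
  | Saturated.
Arguments Intercept {M}.
Arguments Saturated {M}.

Definition full_model {M : nat} : model M := Subset [set: 'I_M]%SET.

Section ABC.
Context {R : realType} {n M : nat}.
Variable X : 'M[R]_(n, M).
Implicit Types (y : 'rV[R]_n) (J : model M) (A : {set 'I_M}).

Definition design A : 'M[R]_(n, #|A|) :=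
  colsub (fun k : 'I_#|A| => enum_val k) X.

Definition rank_model J : nat :=
  match J with
  | Subset A => \rank (design A)
  | Intercept => 1
  | Saturated => n
  end.

Definition proj_model J y : 'rV[R]_n :=
  match J with
  | Subset A => y *m colproj (design A)
  | Intercept => const_mx (n%:R^-1 * \sum_(i < n) y ord0 i)
  | Saturated => y
  end.

Definition candidate J : bool :=
  match J with
  | Subset A => (1 <= #|A| <= minn M.-1 n)%N || (#|A| == M)
  | Intercept | Saturated => true
  end.

Definition complexity J : R :=
  match J with
  | Subset A =>
      if (#|A| < M)%N then
        - ln (85 / 100) + ln (minn M.-1 n)%:R + ln 'C(M, #|A|)%:R
      else - ln (5 / 100)
  | Intercept | Saturated => - ln (5 / 100)
  end.

Definition abc (lambda sigma : R) y J : R :=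
  \sum_(i < n) (y ord0 i - proj_model J y ord0 i) ^+ 2
  + 2 * (rank_model J)%:R * sigma ^+ 2 + lambda * sigma ^+ 2 * complexity J.

(* A Borel selection of a minimizer; the tie-breaking is unspecified. *)
Definition abc_selector (lambda sigma : R) (jhat : 'rV[R]_n -> model M) : Prop :=
  [/\ forall y, candidate (jhat y),
      forall y J, candidate J ->
        abc lambda sigma y (jhat y) <= abc lambda sigma y J
    & forall J, measurable
        [set y : n.-tuple R | jhat (\row_(i < n) tnth y i) = J]].

End ABC.

Definition iid_normal {R : realType} {d : measure_display}
    {T : measurableType d} (P : probability T R) {n : nat}
    (eps : 'I_n -> {RV P >-> R}) (sigma : R) : Prop :=
  (forall (i : 'I_n) (A : set R), measurable A ->
     distribution P (eps i) A = normal_prob 0 sigma A) /\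
  (forall A : 'I_n -> set R, (forall i, measurable (A i)) ->
     P (\bigcap_(i in [set: 'I_n]) (eps i @^-1` A i))
     = (\prod_(i < n) P (eps i @^-1` A i))%E).
Arguments iid_normal {R d T} P {n} eps sigma.

Definition risk {R : realType} {d : measure_display}
    {T : measurableType d} (P : probability T R) {n M : nat}
    (X : 'M[R]_(n, M)) (eps : 'I_n -> {RV P >-> R})
    (jhat : 'rV[R]_n -> model M) (mu : 'rV[R]_n) : \bar R :=
  ('E_P[fun w => let y := (mu + \row_(i < n) eps i w)%R in
                 normn2 (proj_model X (jhat y) y - mu)%R])%E.
Arguments risk {R d T} P {n M} X eps jhat mu.

Section Rates.
Context {R : realType}.
Variables (n M r : nat) (sigma : R).

Definition eff_dim (q t : R) : R := (n%:R * t ^+ 2 * sigma ^- 2) `^ (q / 2).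

Definition m_up (q t : R) : nat :=
  minn (minn `|Num.ceil (eff_dim q t)|%N M) n.

Definition m_low (q t : R) : nat :=
  if m_up q t == minn M n then m_up q t
  else `|Num.ceil ((m_up q t)%:R /
                   (1 + ln (M%:R / (m_up q t)%:R)) `^ (q / 2))|%N.

Definition rate_full : R := sigma ^+ 2 * r%:R / n%:R.

Definition Phi_q (q t : R) : R :=
  if m_low q t == minn M n then rate_full
  else if (1 < m_low q t < minn M n)%N then
    Num.min (sigma `^ (2 - q) * t `^ q *
             ((1 + ln (M%:R / eff_dim q t)) / n%:R) `^ (1 - q / 2))
            rate_full
  else Num.min (Num.max (t ^+ 2) (sigma ^+ 2 / n%:R)) rate_full.

Definition Phi_0 (k : nat) : R :=
  Num.min (sigma ^+ 2 * k%:R * (1 + ln (M%:R / k%:R)) / n%:R) rate_full.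

Definition Phi_q0 (q t : R) (k : nat) : R := Num.min (Phi_q q t) (Phi_0 k).

End Rates.

Definition oracle {R : realType} {n M : nat} (X : 'M[R]_(n, M)) (sigma : R)
    (mu : 'rV[R]_n) : R :=
  inf [set normn2 (proj_model X (Subset J) mu - proj_model X full_model mu)
           + sigma ^+ 2 * (rank_model X (Subset J))%:R / n%:R
           + sigma ^+ 2 * ln (minn M n)%:R / n%:R
           + sigma ^+ 2 * ln 'C(M, #|J|)%:R / n%:R
      | J in [set J : {set 'I_M} | (1 <= #|J| < M)%N]].

(* Main.v *)
Require Import Defs.
From mathcomp Require Import all_boot all_order all_algebra.
From mathcomp Require Import all_classical all_reals all_analysis.
From mathcomp Require Import measurable_realfun.
From mathcomp Require Import ring lra zify.

Set Implicit Arguments.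
Unset Strict Implicit.
Unset Printing Implicit Defensive.

Import Order.TTheory GRing.Theory Num.Theory.
Import numFieldNormedType.Exports.

Local Open Scope classical_set_scope.
Local Open Scope ring_scope.

(** The heart of the matter is an oracle inequality: for every candidate model J
    with orthogonal projection Q_J, bias vector c_J = mu - mu Q_J and rank r_J,
      n * risk <= 20 (2 |c_J|^2 + 2 r_J sigma^2 + lambda sigma^2 C_J + 6 sigma^2)
    ([risk_le_candidate]).  Write y = mu + e.  The loss of model J is
    |c_J|^2 + |e Q_J|^2, while its criterion, up to the common term |e|^2, is
      loss + 2 <c_J, e> - 2 |e Q_J|^2 + 2 r_J sigma^2 + lambda sigma^2 C_J.
    Comparing the selected model J' with a fixed J bounds one twentieth of the
    loss of J' by the criterion of J plus the excess
      Z_J' = - 2 <c_J', e> + (21/20) |e Q_J'|^2 - (19/20) |c_J'|^2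
             - 2 r_J' sigma^2 - lambda sigma^2 C_J'.
    As J' depends on the noise, Z_J' is bounded by
    3 sigma^2 exp (Z_J' / (3 sigma^2)), hence by the sum of these exponentials
    over all candidates.  A Gaussian computation gives
    E exp (Z_J / (3 sigma^2)) <= exp (- C_J) ([exp_moment_excess]); this is where
    lambda >= 5.1 ln 2 >= 3 enters.  The complexities satisfy the Kraft inequality
    sum_J exp (- C_J) <= 1 ([kraft]), so the excess costs at most 3 sigma^2 in
    expectation, whatever the number of models.  Only integrals of nonnegative
    functions appear, so no integrability has to be checked.

    The Gaussian computation concerns E exp (k |e Q|^2 / (2 sigma^2) + <b, e>) for b
    orthogonal to the range of Q ([exp_moment_quadratic]).  It is done without
    rotating coordinates, by induction on the rank of Q: a unit vector u is split
    off Q, the exponential of the square <u, e>^2 is written as a Gaussian mixture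
    of exponentials of multiples of <u, e>, and Tonelli reduces to a projection of
    smaller rank.  Independence is needed only for linear exponents, where the
    expectation factors over coordinates ([integral_prod_indep]).

    The rest is the choice of J.  The full, intercept and saturated models give
    the bounds sigma^2 rank X / n, t^2 + sigma^2 / n and sigma^2, up to constants.
    Proper subsets with more than n elements are in the oracle but are not
    candidates; there the full model does as well,
    because rank X <= r_J + 2 ln C(M, |J|) ([full_rank_le_noncandidate]).  For a
    k-sparse theta', a subset of size k containing its support gives
      risk <= B (|mu - X theta'|_n^2 + sigma^2 k (1 + ln (M / k)) / n)
    ([risk_le_sparse]), which is the rate on F_0.  On an l_q ball of radius t, at
    most k coefficients exceed t k^(-1/q); keeping these, and replacing the others
    by a k-sparse vector through a derandomised Maurey argument, gives a
    2k-sparse theta' at squared distance at most t^2 k^(1 - 2/q)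
    ([sparse_approx]).  With E = (n t^2 / sigma^2)^(q/2) and L = 1 + ln (M / E), the
    choice k ~ E / L^(q/2) balances the two terms ([rate_mid]). *)

(** * Integration of nonnegative functions and Gaussian integrals *)

Section LayerCake.
Context {R : realType} {d'} {U : measurableType d'}.
Local Open Scope ereal_scope.

Let leb : {sigma_finite_measure set (measurableTypeR R) -> \bar R} := @lebesgue_measure R.

(** The condition [0 <= t] lets the layer-cake formula integrate t over the whole line. *)
Definition layer (f : U -> R) (t : R) : set U := [set x | 0 <= t < f x]%R.

Lemma measurable_layer (f : U -> R) t : measurable_fun setT f -> measurable (layer f t).
Proof.
move=> mf.
have -> : layer f t = (fun x => (0 <= t)%R && (t < f x)%R) @^-1` [set true].
  by apply/seteqP; split.
rewrite -[X in measurable X]setTI.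
have : measurable_fun setT (fun x => (0 <= t)%R && (t < f x)%R).
  by apply: measurable_and => //; exact: measurable_fun_ltr.
exact.
Qed.

Lemma measurable_layer2 d (T : measurableType d) (g : T -> R) (X : T -> U) (f : U -> R) :
  measurable_fun setT g -> measurable_fun setT X -> measurable_fun setT f ->
  measurable_fun setT (fun z : T * measurableTypeR R => (g z.1 * \1_(layer f z.2) (X z.1))%:E).
Proof.
move=> mg mX mf.
apply/measurable_EFinP; apply: measurable_funM; first exact: measurableT_comp.
pose b (z : T * measurableTypeR R) := ((0 <= z.2)%R && (z.2 < f (X z.1))%R).
have -> : (fun z : T * measurableTypeR R => \1_(layer f z.2) (X z.1)) =
     \1_(b @^-1` [set true]) :> (_ -> R).
  by apply/funext => z; rewrite !indicE.
apply: measurable_indic.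
rewrite -[X in measurable X]setTI.
have : measurable_fun setT b; last exact.
apply: measurable_and.
  by apply: measurable_fun_ler => //; exact: measurable_snd.
apply: measurable_fun_ltr; first exact: measurable_snd.
by apply: measurableT_comp => //; exact: measurableT_comp.
Qed.

(** f = int_0^oo 1_(t < f) dt, followed by Tonelli. *)
Lemma layer_cake d (T : measurableType d) (mu : {sigma_finite_measure set T -> \bar R})
   (g : T -> R) (X : T -> U) (f : U -> R) :
  measurable_fun setT g -> measurable_fun setT X -> measurable_fun setT f ->
  (forall w, 0 <= g w)%R -> (forall x, 0 <= f x)%R ->
  \int[mu]_w (g w * f (X w))%:E =
  \int[leb]_t \int[mu]_w (g w * \1_(layer f t) (X w))%:E.
Proof.
move=> mg mX mf g0 f0.
pose h (z : T * measurableTypeR R) := (g z.1 * \1_(layer f z.2) (X z.1))%:E.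
rewrite -(@fubini_tonelli _ _ _ _ _ mu leb h); [|exact: measurable_layer2|]; last first.
  by move=> z; rewrite /h lee_fin mulr_ge0.
apply: eq_integral => w _; rewrite /h /=.
transitivity (\int[leb]_t ((g w)%:E * (\1_(`[0%R, f (X w)[%classic) t)%:E)) => [|//].
rewrite ge0_integralZl_EFin//; last first.
  by apply/measurable_EFinP; exact: measurable_indic.
rewrite integral_indic//= setIT lebesgue_measure_itv/= lte_fin EFinM.
case: ltgtP (f0 (X w)) => // [|<-] _; first by rewrite oppr0 adde0.
by rewrite mule0.
Qed.

(** An identity known for indicators extends to nonnegative functions by
    integrating over their layers.  With g a density this is the change of
    variables for [normal_prob]; with g a product of independent factors it is
    one step of the factorisation of expectations. *)
Lemma integral_comp_proportional d (T : measurableType d)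
    (mu : {sigma_finite_measure set T -> \bar R})
    (nu : {sigma_finite_measure set U -> \bar R}) (c : \bar R)
    (g : T -> R) (X : T -> U) (f : U -> R) :
  measurable_fun setT g -> measurable_fun setT X -> measurable_fun setT f ->
  (forall w, 0 <= g w)%R -> (forall x, 0 <= f x)%R -> 0 <= c ->
  (forall A : set U, measurable A -> \int[mu]_w (g w * \1_A (X w))%:E = c * nu A) ->
  \int[mu]_w (g w * f (X w))%:E = c * \int[nu]_x (f x)%:E.
Proof.
move=> mg mX mf g0 f0 c0 H.
rewrite layer_cake//.
transitivity (\int[leb]_t (c * nu (layer f t))).
  by apply: eq_integral => t _; rewrite H//; exact: measurable_layer.
have E t : \int[nu]_w (1 * \1_(layer f t) (idfun w))%:E = nu (layer f t).
  under eq_integral do rewrite mul1r.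
  by rewrite integral_indic ?setIT//; exact: measurable_layer.
have mE : measurable_fun setT (fun t => nu (layer f t)).
  under eq_fun do rewrite -E.
  have m1 : measurable_fun setT (cst 1%R : U -> R) by [].
  have m2 : measurable_fun setT (@idfun U) by exact: measurable_id.
  apply: (@measurable_fun_fubini_tonelli_G _ _ _ _ _ nu _ (measurable_layer2 m1 m2 mf)).
  by move=> z; rewrite lee_fin mulr_ge0.
rewrite ge0_integralZl//; congr (_ * _).
under eq_integral do rewrite -E.
rewrite -layer_cake//.
by under eq_integral do rewrite mul1r.
exact: measurable_id.
Qed.
End LayerCake.

Section Monotone.
Context d (T : measurableType d) (R : realType) (mu : {measure set T -> \bar R}).
Local Open Scope ereal_scope.

(** The smaller function need not be measurable: both integrals are suprema over
    the simple functions lying below. *)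
Lemma ge0_le_integralT (f1 f2 : T -> \bar R) : (forall x, 0 <= f1 x) ->
  (forall x, f1 x <= f2 x) -> \int[mu]_x f1 x <= \int[mu]_x f2 x.
Proof.
move=> f10 f12.
have f20 x : 0 <= f2 x by exact: le_trans (f12 x).
rewrite !ge0_integralTE//; apply: le_ereal_sup => _ [h /= hf1 <-].
by exists h => //= x; exact: le_trans (f12 x).
Qed.
End Monotone.

Section NormalDensity.
Context {R : realType}.
Local Open Scope ereal_scope.
Implicit Types (s b : R).

Lemma normal_pdf_expE m s x : s != 0%R ->
  normal_pdf m s x = (normal_peak s * expR (- (x - m) ^+ 2 / (s ^+ 2 *+ 2)))%R.
Proof. by move=> s0; rewrite normal_pdfE. Qed.

Lemma integral_normal_prob m s (f : R -> R) : measurable_fun setT f -> (forall x, 0 <= f x)%R ->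
  \int[normal_prob m s]_x (f x)%:E = \int[lebesgue_measure]_x (normal_pdf m s x * f x)%:E.
Proof.
move=> mf f0; rewrite -[LHS]mul1e.
rewrite -(@integral_comp_proportional _ _ _ _ _ (@lebesgue_measure R)
  (normal_prob m s) 1 (normal_pdf m s) idfun)//.
- exact: measurable_normal_pdf.
- exact: measurable_id.
- by move=> x; exact: normal_pdf_ge0.
- move=> A mA; rewrite mul1e /normal_prob [RHS]integral_mkcond.
  apply: eq_integral => x _; rewrite patchE indicE/=.
  by case: ifPn; rewrite ?mulr1 ?mulr0.
Qed.

(** Completing the square turns the integrand into a shifted normal density. *)
Lemma integral_expR_normal s b : s != 0%R ->
  \int[lebesgue_measure]_x (normal_pdf 0 s x * expR (b * x))%:E = (expR (s ^+ 2 * b ^+ 2 / 2))%:E.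
Proof.
move=> s0.
under eq_integral => x _.
  have -> : (normal_pdf 0 s x * expR (b * x) =
      expR (s ^+ 2 * b ^+ 2 / 2) * normal_pdf (s ^+ 2 * b) s x)%R.
    rewrite !normal_pdf_expE// [RHS]mulrCA -[LHS]mulrA -!expRD; congr (_ * expR _)%R.
    by field.
  rewrite EFinM.
over.
rewrite ge0_integralZl_EFin ?expR_ge0//.
- by rewrite integral_normal_pdf mule1.
- by move=> x _; rewrite lee_fin normal_pdf_ge0.
- by apply/measurable_EFinP; exact: measurable_normal_pdf.
Qed.

(** The integrand is a multiple of the centred normal density of variance 1 / (1 - k). *)
Lemma integral_expR_sqr_normal (k : R) : (0 <= k < 1)%R ->
  \int[lebesgue_measure]_x (normal_pdf 0 1 x * expR (k / 2 * x ^+ 2))%:E =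
  ((Num.sqrt (1 - k))^-1)%:E.
Proof.
move=> /andP[k0 k1].
have k2 : (0 < 1 - k)%R by rewrite subr_gt0.
set v : R := Num.sqrt (1 - k).
have v0 : (0 < v)%R by rewrite sqrtr_gt0.
have v2 : (v ^+ 2 = 1 - k)%R by rewrite sqr_sqrtr// ltW.
have pk : (normal_peak 1 = v^-1 * normal_peak v^-1)%R.
  rewrite /normal_peak expr1n mul1r -mulrnAr sqrtrM ?sqr_ge0// sqrtr_sqr.
  rewrite ger0_norm ?invr_ge0 ?(ltW v0)// invfM invrK mulrA mulVf ?gt_eqF//.
  by rewrite mul1r.
have vn : (v^-1 != 0)%R by rewrite invr_eq0 gt_eqF.
under eq_integral => x _.
  have -> : (normal_pdf 0 1 x * expR (k / 2 * x ^+ 2) = v^-1 * normal_pdf 0 v^-1 x)%R.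
    rewrite !normal_pdf_expE ?oner_eq0// -[LHS]mulrA -expRD [RHS]mulrA; congr (_ * expR _)%R.
      exact: pk.
    rewrite !subr0 expr1n exprVn v2; field.
    by rewrite gt_eqF.
  rewrite EFinM.
over.
rewrite ge0_integralZl_EFin ?invr_ge0 ?(ltW v0)//.
- by rewrite integral_normal_pdf mule1.
- by move=> x _; rewrite lee_fin normal_pdf_ge0.
- by apply/measurable_EFinP; exact: measurable_normal_pdf.
Qed.
End NormalDensity.

(** * Expectation of products of independent variables *)

Section Indep.
Context {R : realType} {d : measure_display} {T : measurableType d} {P : probability T R}.
Local Open Scope ereal_scope.

Lemma integral_indic_comp (X : {RV P >-> R}) (A : set R) : measurable A ->
  \int[P]_w (\1_A (X w))%:E = P (X @^-1` A).
Proof.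
move=> mA; rewrite -[in RHS](setIT (X @^-1` A)) -integral_indic//.
by rewrite -[X in measurable X]setTI; exact: measurable_funPT.
Qed.

(** Independence is the case of indicators; they are replaced by the given
    functions one index after the other. *)
Lemma integral_prod_indep n (X : 'I_n -> {RV P >-> R}) (h : 'I_n -> R -> R) :
  (forall A : 'I_n -> set R, (forall i, measurable (A i)) ->
     P (\bigcap_(i in [set: 'I_n]) (X i @^-1` A i)) = \prod_(i < n) P (X i @^-1` A i)) ->
  (forall i, measurable_fun setT (h i)) -> (forall i x, (0 <= h i x)%R) ->
  \int[P]_w (\prod_(i < n) h i (X i w))%:E = \prod_(i < n) \int[P]_w (h i (X i w))%:E.
Proof.
move=> ind mh h0.
(* functions of index at least k are still indicators *)
suff: forall k (h : 'I_n -> R -> R),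
  (forall i, measurable_fun setT (h i)) -> (forall i x, (0 <= h i x)%R) ->
  (forall i : 'I_n, (k <= i)%N -> exists2 A : set R, measurable A & h i = \1_A) ->
  \int[P]_w (\prod_(i < n) h i (X i w))%:E = \prod_(i < n) \int[P]_w (h i (X i w))%:E.
  move=> /(_ n h mh h0); apply => i; by rewrite leqNgt ltn_ord.
elim => [|k IH] {mh h0}h mh h0 hk.
  have /choice[A HA] : forall i, exists A : set R, measurable A /\ h i = \1_A.
    by move=> i; have [A mA hA] := hk i (leq0n _); exists A.
  have -> : \prod_(i < n) \int[P]_w (h i (X i w))%:E = \prod_(i < n) P (X i @^-1` A i).
    apply: eq_bigr => i _; have [mA ->] := HA i; exact: integral_indic_comp.
  rewrite -ind; last by move=> i; exact: (HA i).1.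
  rewrite -[in RHS](setIT (\bigcap_(i in _) _)) -integral_indic//; last first.
    apply: fin_bigcap_measurable => // i _.
    by rewrite -[X in measurable X]setTI; apply: measurable_funPT => //; exact: (HA i).1.
  apply: eq_integral => w _; congr (_%:E).
  under eq_bigr do rewrite (HA _).2 indicE.
  rewrite indicE; case: (boolP (w \in _)) => wA.
    rewrite big1// => i _; rewrite mem_set//.
    by move: wA; rewrite inE => /(_ i); exact.
  apply/eqP/prodf_eq0; move: wA; apply: contraNP => Hw.
  rewrite inE => i _ /=; apply: contrapT => NA; apply: Hw; exists i => //.
  by rewrite memNset.
have [kn|nk] := ltnP k n; last first.
  by apply: IH => // i ki; have := leq_trans nk ki; rewrite leqNgt ltn_ord.
pose i0 := Ordinal kn.
pose g w := (\prod_(i < n | i != i0) h i (X i w))%R.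
rewrite [RHS](bigD1 i0)//= muleC.
under eq_integral => w _ do rewrite (bigD1 i0)//= mulrC.
rewrite (@integral_comp_proportional _ _ _ _ _ P (distribution P (X i0))
  (\prod_(i < n | i != i0) \int[P]_w (h i (X i w))%:E) g (X i0))//.
- rewrite ge0_integral_distribution//; last by move=> y; rewrite lee_fin.
  by apply/measurable_EFinP.
- have -> : g = fun w => (\prod_(i < n) (if i != i0 then h i (X i w) else 1))%R.
    by apply/funext => w; rewrite /g big_mkcond.
  apply: measurable_prod => i _; case: eqP => /= _; first exact: measurable_cst.
  exact: measurableT_comp.
- by move=> w; apply: prodr_ge0.
- apply: prode_ge0 => i _; apply: integral_ge0 => w _; by rewrite lee_fin.
- move=> A mA.
  pose h' i := if i == i0 then \1_A else h i.
  have h'0 : h' i0 = \1_A by rewrite /h' eqxx.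
  have h'E i : i != i0 -> h' i = h i by move=> /negbTE; rewrite /h' => ->.
  transitivity (\int[P]_w (\prod_(i < n) h' i (X i w))%:E).
    apply: eq_integral => w _; rewrite [in RHS](bigD1 i0)//= h'0 mulrC /g.
    by under [in RHS]eq_bigr => i ii0 do rewrite h'E//.
  rewrite IH.
  + rewrite (bigD1 i0)//= h'0 integral_indic_comp// muleC; congr (_ * _).
    by apply: eq_bigr => i ii0; rewrite h'E.
  + by move=> i; rewrite /h'; case: eqP => // _; exact: measurable_indic.
  + by move=> i x; rewrite /h'; case: eqP => // _; rewrite indicE.
  + move=> i ki; rewrite /h'; case: eqP => [_|/eqP ii]; first by exists A.
    by apply: hk; rewrite ltn_neqAle ki andbT eq_sym.
Qed.
End Indep.

(** * Euclidean geometry of row vectors and orthogonal projections *)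

Definition dotp {R : realType} {n : nat} (u v : 'rV[R]_n) : R := (u *m v^T) ord0 ord0.
Local Notation sqn u := (dotp u u).

Section Dot.
Context {R : realType} {n : nat}.
Implicit Types (u v w : 'rV[R]_n) (Q : 'M[R]_n).

Lemma dotpE u v : dotp u v = \sum_i u ord0 i * v ord0 i.
Proof. by rewrite /dotp mxE; apply: eq_bigr => i _; rewrite mxE. Qed.

Lemma sqnE u : sqn u = \sum_i u ord0 i ^+ 2.
Proof. by rewrite dotpE; apply: eq_bigr => i _; rewrite expr2. Qed.

Lemma normn2E u : normn2 u = n%:R^-1 * sqn u.
Proof. by rewrite sqnE. Qed.

Lemma dotpC u v : dotp u v = dotp v u.
Proof. by rewrite !dotpE; apply: eq_bigr => i _; rewrite mulrC. Qed.

Lemma dotpDl u v w : dotp (u + v) w = dotp u w + dotp v w.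
Proof. by rewrite /dotp mulmxDl mxE. Qed.
Lemma dotpDr u v w : dotp w (u + v) = dotp w u + dotp w v.
Proof. by rewrite dotpC dotpDl !(dotpC w). Qed.
Lemma dotpZl a u w : dotp (a *: u) w = a * dotp u w.
Proof. by rewrite /dotp -scalemxAl mxE. Qed.
Lemma dotpZr a u w : dotp w (a *: u) = a * dotp w u.
Proof. by rewrite dotpC dotpZl dotpC. Qed.
Lemma dotpNl u w : dotp (- u) w = - dotp u w.
Proof. by rewrite -scaleN1r dotpZl mulN1r. Qed.
Lemma dotpNr u w : dotp w (- u) = - dotp w u.
Proof. by rewrite dotpC dotpNl dotpC. Qed.
Lemma dotp0l w : dotp 0 w = 0. Proof. by rewrite /dotp mul0mx mxE. Qed.
Lemma dotp0r w : dotp w 0 = 0. Proof. by rewrite dotpC dotp0l. Qed.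

Definition dotp_bilinE := (dotpDl, dotpDr, dotpNl, dotpNr, dotpZl, dotpZr).

Lemma sqn_ge0 u : 0 <= sqn u.
Proof. by rewrite sqnE; apply: sumr_ge0 => i _; exact: sqr_ge0. Qed.

Lemma sqn_eq0 u : (sqn u == 0) = (u == 0).
Proof.
apply/eqP/eqP => [|->]; last by rewrite dotp0l.
rewrite sqnE => /psumr_eq0P H; apply/rowP => i; rewrite mxE.
by apply/eqP; rewrite -sqrf_eq0; apply/eqP/H => // k _; exact: sqr_ge0.
Qed.

Lemma sqnD u v : sqn (u + v) = sqn u + 2 * dotp u v + sqn v.
Proof. rewrite !dotp_bilinE (dotpC v u); ring. Qed.

Lemma dotp_mulmx u v Q : dotp (u *m Q) v = dotp u (v *m Q^T).
Proof. by rewrite /dotp trmx_mul trmxK mulmxA. Qed.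

Lemma mul_dotp u v w : u *m (v^T *m w) = dotp u v *: w.
Proof. by rewrite mulmxA [u *m _]mx11_scalar mul_scalar_mx. Qed.

(** Matrices act on row vectors from the right. *)
Definition orthoproj Q := Q^T = Q /\ Q *m Q = Q.

Section Proj.
Variable Q : 'M[R]_n.
Hypothesis hQ : orthoproj Q.

Lemma orthoproj_dotp u v : dotp (u *m Q) v = dotp u (v *m Q).
Proof. by rewrite dotp_mulmx hQ.1. Qed.

Lemma orthoprojK u : u *m Q *m Q = u *m Q.
Proof. by rewrite -mulmxA hQ.2. Qed.

Lemma orthoproj_sub u : (u - u *m Q) *m Q = 0.
Proof. by rewrite mulmxBl orthoprojK subrr. Qed.

Lemma orthoproj_orth u v : dotp (u - u *m Q) (v *m Q) = 0.
Proof. by rewrite -orthoproj_dotp orthoproj_sub dotp0l. Qed.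

Lemma orthoproj_pythagoras u : sqn u = sqn (u - u *m Q) + sqn (u *m Q).
Proof.
rewrite -[X in dotp X X = _](subrK (u *m Q)) [LHS]sqnD.
by rewrite orthoproj_orth mulr0 addr0.
Qed.

End Proj.

(** Splitting a unit vector u of its range off an orthogonal projection leaves an
    orthogonal projection of smaller rank; this replaces the choice of an
    orthonormal basis of the range. *)
Lemma orthoproj_peel Q : orthoproj Q -> Q != 0 ->
  exists u, [/\ sqn u = 1, u *m Q = u, orthoproj (Q - u^T *m u),
   (\rank (Q - u^T *m u)%R < \rank Q)%N &
   forall v, sqn (v *m Q) = sqn (v *m (Q - u^T *m u)) + dotp u v ^+ 2].
Proof.
move=> hQ /rowV0Pn[v /submxP[w vw] v0].
have vQ : v *m Q = v by rewrite vw orthoprojK.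
have sv : 0 < sqn v by rewrite lt_neqAle sqn_ge0 eq_sym sqn_eq0 v0.
pose u := (Num.sqrt (sqn v))^-1 *: v; exists u.
have u1 : sqn u = 1.
  rewrite !dotp_bilinE mulrA -invfM -expr2 sqr_sqrtr ?ltW// mulVf// gt_eqF//.
have uQ : u *m Q = u by rewrite -scalemxAl vQ.
clearbody u.
have QuT : Q *m u^T = u^T by rewrite -{1}hQ.1 -trmx_mul uQ.
have uuT : u *m u^T = 1%:M by rewrite [LHS]mx11_scalar -/(dotp u u) u1.
set Q' := Q - u^T *m u.
have uQ' : u *m Q' = 0 by rewrite mulmxBr uQ mulmxA uuT mul1mx subrr.
have Q'uT : Q' *m u^T = 0 by rewrite mulmxBl QuT -mulmxA uuT mulmx1 subrr.
have Q'Q : Q' *m Q = Q'.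
  by rewrite mulmxBl hQ.2 -mulmxA uQ.
have oQ' : orthoproj Q'.
  split; first by rewrite linearB/= hQ.1 trmx_mul trmxK.
  by rewrite {2}/Q' mulmxBr Q'Q mulmxA Q'uT mul0mx subr0.
split=> //.
  apply: rank_ltmx; rewrite /ltmx -{1}Q'Q submxMl/=.
  apply/negP => /(submx_trans _) H.
  have /submxP[x ux] : (u <= Q')%MS by apply: H; rewrite -uQ submxMl.
  have : u *m Q' = u by rewrite ux -mulmxA oQ'.2.
  rewrite uQ' => u0; move: u1; rewrite -u0 dotp0l => /esym/eqP.
  by rewrite oner_eq0.
move=> x.
have -> : x *m Q = x *m Q' + dotp u x *: u.
  by rewrite mulmxBr mul_dotp (dotpC u) subrK.
have xu : dotp (x *m Q') u = 0 by rewrite dotp_mulmx oQ'.1 uQ' dotp0r.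
rewrite sqnD dotpZr xu !dotp_bilinE u1; ring.
Qed.
End Dot.

(** * Exponential moments of Gaussian noise *)

Section Moments.
Context {R : realType} {d : measure_display} {T : measurableType d} {P : probability T R}.
Context {n : nat} (eps : 'I_n -> {RV P >-> R}) (sigma : R).
Hypotheses (iid : iid_normal P eps sigma) (s0 : 0 < sigma).

Definition noise (w : T) : 'rV[R]_n := \row_(i < n) eps i w.

Lemma measurable_dotp_noise b : measurable_fun setT (fun w => dotp b (noise w)).
Proof.
under eq_fun do rewrite dotpE.
apply: measurable_sum => i; under eq_fun do rewrite mxE.
by apply: measurable_funM => //; exact: measurable_cst.
Qed.

Lemma measurable_sqn_noise (Q : 'M[R]_n) : measurable_fun setT (fun w => sqn (noise w *m Q)).
Proof.
under eq_fun do rewrite sqnE.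
apply: measurable_sum => i; apply: measurable_funX.
under eq_fun do rewrite mxE.
apply: measurable_sum => j; under eq_fun do rewrite mxE.
by apply: measurable_funM => //; exact: measurable_cst.
Qed.

Local Open Scope ereal_scope.

(** The expectation factors over the independent coordinates. *)
Lemma exp_moment_linear b :
  \int[P]_w (expR (dotp b (noise w)))%:E = (expR (sigma ^+ 2 * sqn b / 2))%:E.
Proof.
transitivity (\int[P]_w (\prod_(i < n) expR (b ord0 i * eps i w))%:E).
  apply: eq_integral => w _; rewrite dotpE expR_sum.
  by under eq_bigr do rewrite mxE.
rewrite (@integral_prod_indep _ _ _ P n eps (fun i x => expR (b ord0 i * x)) iid.2)//.
- transitivity (\prod_(i < n) (expR (sigma ^+ 2 * b ord0 i ^+ 2 / 2))%:E).
    apply: eq_bigr => i _; rewrite -integral_expR_normal ?gt_eqF//.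
    have mf : measurable_fun setT (fun x : R => expR (b ord0 i * x)).
      by apply: measurableT_comp => //; exact: measurable_funM.
    rewrite -(integral_normal_prob 0 sigma mf)//.
    under eq_integral => w _ do rewrite -[expR _]mul1r.
    rewrite (@integral_comp_proportional _ _ _ _ _ P (normal_prob 0 sigma) 1
      (cst 1%R) (eps i) (fun x => expR (b ord0 i * x)))//.
    + by rewrite mul1e.
    + have me : measurable_fun setT (eps i : T -> R) by exact: measurable_funPT.
      exact: me.
    + move=> A mA; under eq_integral => w _ do rewrite mul1r.
      by rewrite integral_indic_comp// mul1e; exact: iid.1.
  rewrite prodEFin -expR_sum; congr (expR _)%:E.
  by rewrite sqnE big_distrr/= big_distrl.
- by move=> i; apply: measurableT_comp => //; exact: measurable_funM.
Qed.

Let measurable_expR_comp (f : T -> R) :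
  measurable_fun setT f -> measurable_fun setT (fun w => (expR (f w))%:E).
Proof. by move=> mf; apply/measurable_EFinP; exact: measurableT_comp. Qed.

(** A chi-square exponential moment.  Induction on r: [orthoproj_peel] gives
    |e Q|^2 = |e Q'|^2 + <u, e>^2, and
    exp (k <u, e>^2 / (2 sigma^2)) = int exp (c x <u, e>) dN(0,1)(x) with
    c = sqrt k / sigma.  After exchanging the integrals the induction hypothesis
    applies to Q' with b + c x u in place of b, which is again orthogonal to the
    range of Q' and has squared norm |b|^2 + c^2 x^2; integrating over x produces
    one more factor 1 / sqrt (1 - k). *)
Lemma exp_moment_quadratic (k : R) r Q b : (0 <= k < 1)%R ->
  orthoproj Q -> (\rank Q <= r)%N -> b *m Q = 0%R ->
  \int[P]_w (expR (k / (2 * sigma ^+ 2) * sqn (noise w *m Q) + dotp b (noise w)))%:E <=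
  ((Num.sqrt (1 - k))^-1 ^+ r * expR (sigma ^+ 2 * sqn b / 2))%:E.
Proof.
move=> /[dup] k01 /andP[k0 k1].
have k2 : (0 < 1 - k)%R by rewrite subr_gt0.
set rho : R := (Num.sqrt (1 - k))^-1%R.
have rho1 : (1 <= rho)%R.
  rewrite invr_ge1 ?unitfE ?gt_eqF ?sqrtr_gt0//.
  by rewrite -[leRHS]sqrtr1 ler_wsqrtr// gerBl.
have sn0 : (sigma != 0)%R by rewrite gt_eqF.
elim: r Q b => [|r IH] Q b hQ rQ bQ.
  rewrite expr0 mul1r -(exp_moment_linear b).
  have -> : Q = 0%R by apply/eqP; rewrite -mxrank_eq0 -leqn0.
  by under eq_integral do rewrite mulmx0 dotp0l mulr0 add0r.
have [Q0|/(orthoproj_peel hQ)[u [u1 uQ]]] := eqVneq Q 0%R.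
  have := IH Q b hQ _ bQ; rewrite Q0 mxrank0 => /(_ (leq0n _)) /le_trans; apply.
  rewrite lee_fin ler_wpM2r ?expR_ge0// exprS ler_peMl// exprn_ge0// (le_trans _ rho1)//.
set Q' := (Q - u^T *m u)%R => oQ' rQ' sQ'.
have bu : dotp b u = 0%R by rewrite -uQ -orthoproj_dotp// bQ dotp0l.
pose c : R := (Num.sqrt k / sigma)%R.
have c2 : (c ^+ 2 = k / sigma ^+ 2)%R by rewrite expr_div_n sqr_sqrtr.
have bQ' x : ((b + (c * x) *: u) *m Q' = 0)%R.
  rewrite mulmxDl -scalemxAl !mulmxBr bQ uQ !mul_dotp bu u1.
  by rewrite scale0r scale1r !subrr scaler0 addr0.
have sb x : (sqn (b + (c * x) *: u) = sqn b + c ^+ 2 * x ^+ 2)%R.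
  by rewrite sqnD !dotp_bilinE bu u1; ring.
pose F w : R := (k / (2 * sigma ^+ 2) * sqn (noise w *m Q') + dotp b (noise w))%R.
pose h (z : T * measurableTypeR R) : \bar R :=
  (normal_pdf 0 1 z.2 * expR (F z.1 + (c * dotp u (noise z.1)) * z.2))%:E.
have mF : measurable_fun setT F.
  apply: measurable_funD; last exact: measurable_dotp_noise.
  by apply: measurable_funM => //; exact: measurable_sqn_noise.
have -> : \int[P]_w
    (expR (k / (2 * sigma ^+ 2) * sqn (noise w *m Q) + dotp b (noise w)))%:E =
   \int[P]_w \int[lebesgue_measure]_x h (w, x).
  apply: eq_integral => w _; rewrite /h/=.
  under [RHS]eq_integral do rewrite expRD mulrCA EFinM.
  rewrite ge0_integralZl_EFin ?expR_ge0//; last 2 first.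
  - by move=> x _; rewrite lee_fin mulr_ge0 ?expR_ge0 ?normal_pdf_ge0.
  - apply/measurable_EFinP; apply: measurable_funM; first exact: measurable_normal_pdf.
    by apply: measurableT_comp => //; exact: measurable_funM.
  rewrite integral_expR_normal ?oner_eq0// -EFinM -expRD /F sQ' exprMn c2.
  congr (expR _)%:E.
  field.
  by rewrite sn0.
rewrite (@fubini_tonelli _ _ _ _ _ P lebesgue_measure h)/=; last 2 first.
- apply/measurable_EFinP; apply: measurable_funM.
    by apply: (measurableT_comp (measurable_normal_pdf 0 1)); exact: measurable_snd.
  apply: measurableT_comp => //; apply: measurable_funD.
    by apply: measurableT_comp => //; exact: measurable_fst.
  apply: measurable_funM; last exact: measurable_snd.
  apply: (measurableT_comp (f := fun w => c * dotp u (noise w))%R); last exact: measurable_fst.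
  by apply: measurable_funM => //; exact: measurable_dotp_noise.
- by move=> z; rewrite /h lee_fin mulr_ge0 ?expR_ge0 ?normal_pdf_ge0.
have -> : (rho ^+ r.+1 * expR (sigma ^+ 2 * sqn b / 2))%:E =
  \int[lebesgue_measure]_x ((rho ^+ r * expR (sigma ^+ 2 * sqn b / 2))%:E *
    (normal_pdf 0 1 x * expR (k / 2 * x ^+ 2))%:E).
  rewrite ge0_integralZl_EFin//.
  - by rewrite integral_expR_sqr_normal// -EFinM exprSr mulrAC.
  - by move=> x _; rewrite lee_fin mulr_ge0 ?expR_ge0 ?normal_pdf_ge0.
  - apply/measurable_EFinP; apply: measurable_funM; first exact: measurable_normal_pdf.
    by apply: measurableT_comp => //; apply: measurable_funM => //; exact: measurable_funX.
  - by rewrite mulr_ge0 ?expR_ge0 ?exprn_ge0// (le_trans _ rho1).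
apply: ge0_le_integralT => x.
  by apply: integral_ge0 => w _; rewrite lee_fin mulr_ge0 ?expR_ge0 ?normal_pdf_ge0.
rewrite /h/=; under eq_integral do rewrite EFinM.
rewrite ge0_integralZl_EFin ?normal_pdf_ge0//; last first.
  apply: measurable_expR_comp; apply: measurable_funD => //.
  by apply: measurable_funM => //; apply: measurable_funM => //; exact: measurable_dotp_noise.
rewrite -EFinM mulrCA EFinM lee_wpmul2l ?lee_fin ?normal_pdf_ge0//.
have := IH Q' (b + (c * x) *: u)%R oQ' (leq_trans rQ' rQ) (bQ' x).
have -> : \int[P]_w (expR (k / (2 * sigma ^+ 2) * sqn (noise w *m Q')
    + dotp (b + (c * x) *: u) (noise w)))%:E =
  \int[P]_w (expR (F w + c * dotp u (noise w) * x))%:E.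
  by apply: eq_integral => w _; rewrite dotpDl dotpZl addrA [(c * x * _)%R]mulrAC.
move=> /le_trans; apply; rewrite lee_fin sb c2 -[(rho ^+ r * _ * _)%R]mulrA -expRD.
rewrite ler_wpM2l ?exprn_ge0 ?(le_trans _ rho1)// ler_expR.
rewrite le_eqVlt; apply/orP; left; apply/eqP.
field.
by rewrite sn0.
Qed.
End Moments.

(** * Models as orthogonal projections *)

Section Models.
Context {R : realType} {n M : nat} (X : 'M[R]_(n, M)).

Lemma colproj_subV p (V : 'M[R]_(n, p)) : (colproj V <= V^T)%MS.
Proof. by apply/row_subP => i; rewrite rowE colproj_sub. Qed.

Lemma colproj_compl p (V : 'M[R]_(n, p)) : (1%:M - colproj V) *m V = 0.
Proof.
apply/row_matrixP => i.
by rewrite row_mul rowE mulmxBr mulmx1 colproj_orth row0.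
Qed.

(** The residual of [colproj] is orthogonal to its range, i.e. Q^T = Q Q^T, which
    is symmetric. *)
Lemma colproj_orthoproj p (V : 'M[R]_(n, p)) : orthoproj (colproj V).
Proof.
set Q := colproj V.
have E : Q^T = Q *m Q^T.
  have /submxP[W QW] := colproj_subV V.
  apply/eqP; rewrite -subr_eq0 -{1}[Q^T]mul1mx -mulmxBl.
  have -> : Q^T = V *m W^T by rewrite [Q]QW trmx_mul trmxK.
  by rewrite mulmxA colproj_compl mul0mx.
clearbody Q; have E2 : Q = Q *m Q^T by have := congr1 trmx E; rewrite trmx_mul !trmxK.
have S : Q^T = Q by rewrite E -E2.
by split=> //; rewrite [RHS]E2 S.
Qed.

Lemma colproj_rank p (V : 'M[R]_(n, p)) : (\rank (colproj V) <= \rank V)%N.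
Proof. by rewrite -(mxrank_tr V); apply: mxrankS; exact: colproj_subV. Qed.

Lemma colproj_fix p (V : 'M[R]_(n, p)) (v : 'rV[R]_n) : (v <= V^T)%MS -> v *m colproj V = v.
Proof.
move=> /submxP[w vw]; have hQ := colproj_orthoproj V.
have : V^T *m colproj V = V^T.
  have /(congr1 trmx) := colproj_compl V.
  rewrite trmx0 trmx_mul linearB/= trmx1 hQ.1 mulmxBr mulmx1 => /eqP.
  by rewrite subr_eq0 => /eqP.
by rewrite vw -mulmxA => ->.
Qed.

Definition proj_mat (J : model M) : 'M[R]_n :=
  match J with
  | Subset A => colproj (design X A)
  | Intercept => const_mx n%:R^-1
  | Saturated => 1%:M
  end.

Lemma proj_modelE J y : proj_model X J y = y *m proj_mat J.
Proof.
case: J => [A||]//=; last by rewrite mulmx1.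
apply/rowP => i; rewrite !mxE mulr_sumr; apply: eq_bigr => j _.
by rewrite mxE mulrC.
Qed.

Lemma proj_mat_orthoproj J : (0 < n)%N -> orthoproj (proj_mat J).
Proof.
move=> n0; case: J => [A||]/=; first exact: colproj_orthoproj.
  split; first by rewrite trmx_const.
  apply/matrixP => i j; rewrite !mxE.
  under eq_bigr do rewrite !mxE.
  rewrite sumr_const card_ord -[LHS]mulr_natl mulrA divff ?mul1r//.
  by rewrite pnatr_eq0 -lt0n.
by split; rewrite ?trmx1 ?mulmx1.
Qed.

Lemma proj_mat_rank J : (\rank (proj_mat J) <= rank_model X J)%N.
Proof.
case: J => [A||]/=; first exact: colproj_rank.
  have -> : const_mx n%:R^-1 = (const_mx n%:R^-1 : 'cV[R]_n) *m (const_mx 1 : 'rV[R]_n).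
    by apply/matrixP => i j; rewrite !mxE big_ord1 !mxE mulr1.
  by rewrite (leq_trans (mxrankM_maxl _ _))// rank_leq_col.
exact: rank_leq_row.
Qed.

End Models.

Section Spans.
Context {R : realType} {n M : nat} (X : 'M[R]_(n, M)).
Implicit Types (A B : {set 'I_M}) (mu v : 'rV[R]_n).

Lemma row_design A j : j \in A -> (row j X^T <= (design X A)^T)%MS.
Proof.
move=> jA; have -> : row j X^T = row (enum_rank_in jA j) (design X A)^T.
  by apply/rowP => i; rewrite !mxE enum_rankK_in.
exact: row_sub.
Qed.

Lemma design_sub A : ((design X A)^T <= X^T)%MS.
Proof.
apply/row_subP => i.
have -> : row i (design X A)^T = row (enum_val i) X^T by apply/rowP => k; rewrite !mxE.
exact: row_sub.
Qed.

Lemma design_full : (X^T <= (design X [set: 'I_M]%SET)^T)%MS.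
Proof. by apply/row_subP => i; apply: row_design; rewrite inE. Qed.

Lemma supp_sub_design A (theta : 'rV[R]_M) :
  (forall j, theta ord0 j != 0 -> j \in A) -> (theta *m X^T <= (design X A)^T)%MS.
Proof.
move=> H; rewrite mulmx_sum_row; apply: summx_sub => j _.
have [->|t0] := eqVneq (theta ord0 j) 0; first by rewrite scale0r sub0mx.
by apply: scalemx_sub; apply: row_design; exact: H.
Qed.

Lemma rank_model_full : rank_model X full_model = \rank X.
Proof.
apply/eqP; rewrite /= -mxrank_tr -(mxrank_tr X) eqn_leq; apply/andP; split; apply: mxrankS.
  exact: design_sub.
exact: design_full.
Qed.

Lemma rank_full_le : (\rank X <= minn M n)%N.
Proof. by rewrite leq_min rank_leq_row rank_leq_col. Qed.

(** Each column outside A adds at most one to the rank. *)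
Lemma rank_full_le_subset A : (\rank X <= \rank (design X A) + (M - #|A|))%N.
Proof.
have H : (X^T <= (design X A)^T + (design X (~: A))^T)%MS.
  apply/row_subP => j; have [jA|jA] := boolP (j \in A).
    exact: submx_trans (row_design jA) (addsmxSl _ _).
  apply: submx_trans (addsmxSr _ _); apply: row_design; by rewrite inE.
rewrite -(mxrank_tr X) (leq_trans (mxrankS H))// (leq_trans (mxrank_adds_leqif _ _))//.
rewrite !mxrank_tr leq_add2l (leq_trans (rank_leq_col _))//.
by rewrite cardsCs finset.setCK card_ord.
Qed.

Lemma proj_in_range A v : (v <= (design X A)^T)%MS -> v *m proj_mat X (Subset A) = v.
Proof. exact: colproj_fix. Qed.

Lemma sqn_proj_le A mu v : (v <= (design X A)^T)%MS ->
  sqn (mu - mu *m proj_mat X (Subset A)) <= sqn (mu - v).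
Proof.
move=> /proj_in_range vQ; have hQ : orthoproj (proj_mat X (Subset A)) by exact: colproj_orthoproj.
rewrite [leRHS](orthoproj_pythagoras hQ).
have -> : mu - v - (mu - v) *m proj_mat X (Subset A) = mu - mu *m proj_mat X (Subset A).
  by rewrite mulmxBl vQ opprB addrA subrK.
by rewrite lerDl sqn_ge0.
Qed.

Lemma sqn_proj_full A mu :
  sqn (mu - mu *m proj_mat X (Subset A)) =
  sqn (mu - mu *m proj_mat X full_model) +
  sqn (mu *m proj_mat X (Subset A) - mu *m proj_mat X full_model).
Proof.
set P := proj_mat X full_model; set Q := proj_mat X (Subset A).
have hP : orthoproj P by exact: colproj_orthoproj.
have QP : mu *m Q *m P = mu *m Q.
  apply: proj_in_range; apply: submx_trans design_full.
  by apply: submx_trans (design_sub A); exact: colproj_sub.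
rewrite [LHS](orthoproj_pythagoras hP).
rewrite mulmxBl QP opprB addrA subrK; congr (_ + _).
by rewrite -opprB dotpNl dotpNr opprK.
Qed.

End Spans.

(** * Complexities and the Kraft inequality *)

Section Numeric.
Context {R : realType}.

(** It suffices that 51/10 * ln 2 >= 3. *)
Lemma ln2_lb : 10 / 17 <= ln 2 :> R.
Proof.
rewrite -[leLHS]expRK ler_ln ?posrE ?expR_gt0//.
have e1 : expR (1 / 10 : R) <= 10 / 9.
  rewrite -[leLHS]invrK -expRN -[leRHS]invf_div lef_pV2 ?posrE ?expR_gt0//.
  have := expR_ge1Dx (- (1 / 10) : R); lra.
apply: (@le_trans _ _ (expR (1 / 10 : R) ^+ 6)).
  rewrite -expRM_natl ler_expR; lra.
apply: (@le_trans _ _ ((10 / 9) ^+ 6)).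
  by rewrite lerXn2r ?nnegrE ?expR_ge0//.
lra.
Qed.

(** Equivalent to (1 - 7/10)^(-1/2) <= exp (2/3): one degree of freedom of the
    chi-square moment is paid for by the rank penalty. *)
Lemma expR_43_lb : 10 / 3 <= expR (4 / 3) :> R.
Proof.
apply: (@le_trans _ _ (expR (1 / 6 : R) ^+ 8)); last first.
  rewrite -expRM_natl ler_expR; lra.
apply: (@le_trans _ _ ((7 / 6) ^+ 8)); first lra.
rewrite lerXn2r ?nnegrE ?expR_ge0//.
have := expR_ge1Dx (1 / 6 : R); lra.
Qed.

End Numeric.

Section Binomials.
Context {R : realType}.

(** The term of index k in the binomial expansion of (1 + k/M)^M, which is at most
    exp k. *)
Lemma ln_bin_le M k : (0 < k <= M)%N ->
  ln 'C(M, k)%:R <= k%:R * (1 + ln (M%:R / k%:R)) :> R.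
Proof.
move=> /andP[k0 kM].
have M0 : (0 < M)%N by exact: leq_trans kM.
have k0R : (0 : R) < k%:R by rewrite ltr0n.
have M0R : (0 : R) < M%:R by rewrite ltr0n.
have C0 : (0 : R) < 'C(M, k)%:R by rewrite ltr0n bin_gt0.
pose x : R := k%:R / M%:R.
have x0 : 0 < x by rewrite divr_gt0.
have H : 'C(M, k)%:R * x ^+ k <= expR k%:R.
  apply: (@le_trans _ _ ((1 + x) ^+ M)).
    rewrite exprDn (bigD1 (Ordinal (kM : (k < M.+1)%N)))//= expr1n mul1r mulr_natl lerDl.
    by apply: sumr_ge0 => i _; rewrite expr1n mul1r mulrn_wge0// exprn_ge0// ltW.
  apply: (@le_trans _ _ (expR x ^+ M)).
    rewrite lerXn2r ?nnegrE ?expR_ge0 ?expR_ge1Dx//.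
    by rewrite addr_ge0// ltW.
  by rewrite -expRM_natr /x divfK// gt_eqF.
move: H; rewrite -ler_ln ?posrE ?expR_gt0 ?mulr_gt0 ?exprn_gt0// expRK.
rewrite lnM ?posrE ?exprn_gt0// lnXn// -mulr_natl.
have -> : ln x = - ln (M%:R / k%:R).
  by rewrite /x -invf_div lnV ?posrE ?divr_gt0.
lra.
Qed.

Lemma ln_bin_lb M m : (0 < m < M)%N -> 1 / 2 * (minn m (M - m))%:R <= ln 'C(M, m)%:R :> R.
Proof.
move=> /andP[m0 mM].
have H : forall a b, (a <= b)%N -> (2 ^ a <= 'C(a + b, a))%N.
  elim => [|a IH] b ab; first by rewrite bin0.
  have E := mul_bin_diag (a + b).+1 a; rewrite addSn.
  have {}IH := IH b (ltnW ab).
  have : (a.+1 * 2 ^ a.+1 <= a.+1 * 'C((a + b).+1, a.+1))%N.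
    rewrite -E expnS mulnA; apply: leq_mul => //; lia.
  by rewrite leq_pmul2l.
have H2 : (2 ^ minn m (M - m) <= 'C(M, m))%N.
  have [h|h] := leqP m (M - m).
    by have := H _ _ h; rewrite subnKC// ltnW.
  have := H _ _ (ltnW h); rewrite subnK ?(ltnW mM)//.
  by rewrite bin_sub// ltnW.
have : ln (2 ^+ minn m (M - m)) <= ln 'C(M, m)%:R :> R.
  by rewrite ler_ln ?posrE ?exprn_gt0 ?ltr0n ?bin_gt0 ?(ltnW mM)// -natrX ler_nat.
apply: le_trans; rewrite lnXn// -[leRHS]mulr_natl [leLHS]mulrC ler_wpM2l//.
have := @ln2_lb R; lra.
Qed.

Lemma ln20_le : - ln (5 / 100) <= 19 :> R.
Proof.
rewrite -lnV ?posrE; last lra.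
rewrite invf_div (_ : 100 / 5 = 1 + 19); last lra.
by apply: le_ln1Dx; lra.
Qed.

End Binomials.

Section SubsetCard.
Lemma superset_card (M k : nat) (S : {set 'I_M}) : (#|S| <= k <= M)%N ->
  exists2 A : {set 'I_M}, S \subset A & #|A| = k.
Proof.
move=> /andP[Sk kM]; elim: k kM Sk => [|k IH] kM Sk.
  by exists S => //; apply/eqP; rewrite -leqn0.
move: Sk; rewrite leq_eqVlt => /orP[/eqP Sk|Sk]; first by exists S.
have [A SA Ak] := IH (ltnW kM) Sk.
have /subsetPn[x _ xA] : ~~ ([set: 'I_M]%SET \subset A).
  by apply: contraL kM => /subset_leq_card; rewrite cardsT card_ord Ak -ltnNge ltnS.
exists (x |: A); first exact: fintype.subset_trans SA (finset.subsetUr _ _).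
by rewrite cardsU1 xA Ak.
Qed.
End SubsetCard.

(** If |A| <= M - |A| then rank X <= n < |A| <= 2 ln C(M, |A|); otherwise the
    M - |A| missing columns add at most 2 ln C(M, |A|) to the rank. *)
Lemma full_rank_le_noncandidate {R : realType} {n M : nat} (X : 'M[R]_(n, M))
    (A : {set 'I_M}) : (1 <= #|A| < M)%N -> (n < #|A|)%N ->
  (\rank X)%:R <= (\rank (design X A))%:R + 2 * ln 'C(M, #|A|)%:R :> R.
Proof.
move=> hA nA; have := @ln_bin_lb R M #|A| hA.
have rX := rank_leq_row X.
have rA := rank_full_le_subset X A.
suff : (\rank X)%:R <= (\rank (design X A))%:R + (minn #|A| (M - #|A|))%:R :> R by lra.
rewrite -natrD ler_nat; have [h|h] := leqP #|A| (M - #|A|) => //.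
exact: leq_trans rX (leq_trans (ltnW nA) (leq_addl _ _)).
Qed.

Section Kraft.
Context {R : realType} (n M : nat).
Hypotheses (n0 : (0 < n)%N) (M2 : (2 <= M)%N).

Lemma ln_bin_ge0 m : (m <= M)%N -> 0 <= ln 'C(M, m)%:R :> R.
Proof. by move=> mM; rewrite ln_ge0// ler1n bin_gt0. Qed.

Lemma complexity_ge0 (J : model M) : @candidate n M J -> 0 <= @complexity R n M J.
Proof.
have l5 : 0 <= - ln (5 / 100) :> R by rewrite oppr_ge0 ln_le0//; lra.
case: J => //= A _; case: ifP => // AM.
rewrite !addr_ge0 ?ln_bin_ge0 ?(ltnW AM)//.
  by rewrite oppr_ge0 ln_le0//; lra.
by rewrite ln_ge0// ler1n leq_min n0 andbT -subn1 subn_gt0.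
Qed.

(** A finite type enumerating the models, over which sums can be taken. *)
Definition model_of (c : {set 'I_M} + bool) : model M :=
  match c with inl A => Subset A | inr true => Intercept | inr false => Saturated end.

Lemma model_ofP J : exists c, model_of c = J.
Proof. by case: J => [A||]; [exists (inl A)|exists (inr true)|exists (inr false)]. Qed.

Lemma sum_card_set (g : nat -> R) :
  \sum_(A : {set 'I_M}) g #|A| = \sum_(m < M.+1) 'C(M, m)%:R * g m.
Proof.
have cM (A : {set 'I_M}) : (#|A| < M.+1)%N by rewrite ltnS -[leqRHS]card_ord max_card.
rewrite (partition_big (fun A : {set 'I_M} => Ordinal (cM A)) predT)//=.
apply: eq_bigr => m _; under eq_bigl do rewrite -val_eqE/=.
rewrite (eq_bigr (fun=> g m)); last by move=> A /eqP ->.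
rewrite sumr_const -[LHS]mulr_natl.
have := card_draws 'I_M m; rewrite card_ord => <-.
by congr (_%:R * _); apply: eq_card => A; rewrite !inE.
Qed.

(** For each m = 1, ..., K, with K = min (M - 1, n), the subsets of size m share the
    mass 85/100 / K; the full model, the intercept and the saturated model have 5/100
    each. *)
Lemma kraft :
  \sum_(c | @candidate n M (model_of c)) expR (- @complexity R n M (model_of c)) <= 1.
Proof.
set K := minn M.-1 n.
have K0 : (0 < K)%N by rewrite leq_min n0 andbT -subn1 subn_gt0.
have K0R : (0 : R) < K%:R by rewrite ltr0n.
have KM : (K < M)%N by rewrite /K; lia.
have e5 : expR (ln (5 / 100)) = 5 / 100 :> R by rewrite lnK// posrE; lra.
rewrite big_sumType/= [X in _ + X]big_mkcond big_bool/= opprK e5.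
pose g m : R :=
  if (m < M)%N then if (1 <= m <= K)%N then 85 / 100 / K%:R / 'C(M, m)%:R else 0
  else 5 / 100.
have -> : \sum_(A : {set 'I_M} | (0 < #|A| <= K)%N || (#|A| == M))
   expR (- (if (#|A| < M)%N then - ln (85 / 100) + ln K%:R + ln 'C(M, #|A|)%:R
               else - ln (5 / 100))) = \sum_(A : {set 'I_M}) g #|A|.
  rewrite big_mkcond; apply: eq_bigr => A _.
  have := max_card (mem A); rewrite card_ord leq_eqVlt /g => /orP[/eqP ->|AM].
    by rewrite eqxx orbT ltnn opprK.
  rewrite AM (ltn_eqF AM) orbF; case: ifP => // _.
  rewrite !opprD opprK 2!expRD !expRN !lnK ?posrE ?ltr0n ?bin_gt0 ?(ltnW AM)//.
rewrite sum_card_set big_ord_recr/= binn mul1r {2}/g ltnn.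
have -> : \sum_(i < M) 'C(M, i)%:R * g i = 85 / 100.
  transitivity (\sum_(i < M | (1 <= i < K.+1)%N) (85 / 100 / K%:R : R)).
    rewrite [RHS]big_mkcond; apply: eq_bigr => m _; rewrite /g ltn_ord ltnS.
    case: ifP => _; last by rewrite mulr0.
    rewrite mulrC mulfVK// pnatr_eq0 -lt0n bin_gt0 ltnW//.
  transitivity (\sum_(1 <= i < K.+1) (85 / 100 / K%:R : R)).
    rewrite (big_nat_widen 1 K.+1 M predT)// (big_nat_widenl 1 0 M)// big_mkord.
    by apply: eq_bigl => i; rewrite andbC.
  rewrite sumr_const_nat subn1 -[LHS]mulr_natr mulfVK//.
  by rewrite gt_eqF.
lra.
Qed.
End Kraft.

(** * The oracle inequality for the selected model *)

Section LossAlgebra.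
Context {R : realType} {n : nat}.
Variables (Q : 'M[R]_n) (mu e : 'rV[R]_n).
Hypothesis hQ : orthoproj Q.
Let c := mu - mu *m Q.

Let cQ : dotp c (e *m Q) = 0. Proof. exact: orthoproj_orth. Qed.

Lemma loss_decomp : sqn ((mu + e) *m Q - mu) = sqn c + sqn (e *m Q).
Proof.
have -> : (mu + e) *m Q - mu = e *m Q - c.
  by rewrite mulmxDl /c opprB [mu *m Q + _]addrC -addrA.
by rewrite sqnD dotpNr dotpC cQ !dotp_bilinE; ring.
Qed.

Lemma residual_decomp :
  sqn (mu + e - (mu + e) *m Q) = sqn c + 2 * dotp c e + sqn e - sqn (e *m Q).
Proof.
have -> : mu + e - (mu + e) *m Q = c + (e - e *m Q).
  by rewrite mulmxDl /c opprD addrACA.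
rewrite sqnD dotpDr dotpNr cQ (orthoproj_pythagoras hQ e); ring.
Qed.
End LossAlgebra.

Section Oracle.
Context {R : realType} {d : measure_display} {T : measurableType d} {P : probability T R}.
Context {n M : nat} (X : 'M[R]_(n, M)) (lambda sigma : R) (eps : 'I_n -> {RV P >-> R})
  (jhat : 'rV[R]_n -> model M).
Hypotheses (n0 : (0 < n)%N) (M2 : (2 <= M)%N) (hl : 51 / 10 * ln 2 <= lambda) (s0 : 0 < sigma)
  (iid : iid_normal P eps sigma) (sel : abc_selector X lambda sigma jhat).
Variable mu : 'rV[R]_n.

Let lambda3 : 3 <= lambda.
Proof. have := @ln2_lb R; move: hl; lra. Qed.

Definition bias J := mu - mu *m proj_mat X J.

Let oP J : orthoproj (proj_mat X J). Proof. exact: proj_mat_orthoproj. Qed.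

Lemma abcE J e : abc X lambda sigma (mu + e) J =
  sqn (bias J) + 2 * dotp (bias J) e + sqn e - sqn (e *m proj_mat X J)
  + 2 * (rank_model X J)%:R * sigma ^+ 2 + lambda * sigma ^+ 2 * @complexity R n M J.
Proof.
rewrite /abc; congr (_ + _ + _); rewrite -residual_decomp//.
rewrite sqnE; apply: eq_bigr => i _; rewrite proj_modelE.
by congr (_ ^+ 2); rewrite [RHS]mxE; congr (_ + _); rewrite [RHS]mxE.
Qed.

(** One twentieth of the loss of J, minus the difference between its criterion and
    |e|^2. *)
Definition excess J (e : 'rV[R]_n) :=
  - 2 * dotp (bias J) e + 21 / 20 * sqn (e *m proj_mat X J) - 19 / 20 * sqn (bias J)
  - 2 * (rank_model X J)%:R * sigma ^+ 2 - lambda * sigma ^+ 2 * @complexity R n M J.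

(** The loss of the selected model is written through its criterion, which is at
    most that of J. *)
Lemma selected_loss_le J e : @candidate n M J ->
  1 / 20 * sqn (proj_model X (jhat (mu + e)) (mu + e) - mu) <=
  sqn (bias J) + 2 * dotp (bias J) e + 2 * (rank_model X J)%:R * sigma ^+ 2
  + lambda * sigma ^+ 2 * @complexity R n M J + excess (jhat (mu + e)) e.
Proof.
move=> cJ; have [_ /(_ (mu + e) J cJ) + _] := sel.
move: (jhat (mu + e)) => J'; rewrite !abcE proj_modelE loss_decomp// -/(bias J') /excess.
have := sqn_ge0 (e *m proj_mat X J).
lra.
Qed.

Let isq : 0 < sigma ^+ 2. Proof. by rewrite exprn_gt0. Qed.

Local Open Scope ereal_scope.

(** The chi-square moment is taken at k = (2/3) (21/20) = 7/10.  The linear term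
    contributes (2/9) |c_J|^2 / sigma^2, less than the (19/60) |c_J|^2 / sigma^2
    subtracted in the excess, the rank penalty absorbs the chi-square factor, and
    lambda / 3 >= 1 leaves exp (- C_J). *)
Lemma exp_moment_excess J : @candidate n M J ->
  \int[P]_w (expR ((3 * sigma ^+ 2)^-1 * excess J (noise eps w)))%:E
   <= (expR (- @complexity R n M J))%:E.
Proof.
move=> cJ.
set C := complexity J; have C0 : (0 <= C)%R by exact: complexity_ge0.
set a := sqn (bias J); have a0 : (0 <= a)%R by exact: sqn_ge0.
set r := rank_model X J.
pose K : R := (- (19 / 60) * (a / sigma ^+ 2) - 2 / 3 * r%:R - lambda / 3 * C)%R.
pose b := ((- (2 / (3 * sigma ^+ 2))) *: bias J)%R.
have sn0 : (sigma != 0)%R by rewrite gt_eqF.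
have bQ : (b *m proj_mat X J = 0)%R.
  by rewrite -scalemxAl orthoproj_sub// scaler0.
under eq_integral => w _.
  rewrite (_ : (3 * sigma ^+ 2)^-1 * _ = K + (7 / 10 / (2 * sigma ^+ 2) *
      sqn (noise eps w *m proj_mat X J) + dotp b (noise eps w)))%R; last first.
    rewrite /K /b /excess dotpZl -/a -/r -/C; field.
    by rewrite sn0.
  rewrite expRD EFinM.
  over.
rewrite ge0_integralZl_EFin ?expR_ge0//; last first.
  apply/measurable_EFinP; apply: measurableT_comp => //; apply: measurable_funD.
    by apply: measurable_funM => //; exact: measurable_sqn_noise.
  exact: measurable_dotp_noise.
apply: (@le_trans _ _ ((expR K)%:E *
  ((Num.sqrt (1 - 7 / 10))^-1 ^+ r * expR (sigma ^+ 2 * sqn b / 2))%:E)).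
  rewrite lee_wpmul2l ?lee_fin ?expR_ge0//.
  apply: exp_moment_quadratic => //; first lra.
  exact: proj_mat_rank.
rewrite -EFinM lee_fin.
apply: (@le_trans _ _ (expR K * (expR (2 / 3 * r%:R) * expR (2 / 9 * (a / sigma ^+ 2)))))%R.
  rewrite ler_wpM2l ?expR_ge0//.
  apply: ler_pM; rewrite ?expR_ge0 ?exprn_ge0 ?invr_ge0 ?sqrtr_ge0//.
    rewrite expRM_natr lerXn2r ?nnegrE ?expR_ge0 ?invr_ge0 ?sqrtr_ge0//.
    rewrite -(@ler_pXn2r _ 2)// ?nnegrE ?expR_ge0 ?invr_ge0 ?sqrtr_ge0//.
    rewrite exprVn sqr_sqrtr; last lra.
    rewrite -expRM_natr; have := @expR_43_lb R.
    rewrite (_ : 4 / 3 = 2 / 3 * 2%:R :> R)%R; last lra.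
    by rewrite (_ : (1 - 7 / 10)^-1 = 10 / 3 :> R)%R//; field.
  rewrite ler_expR /b dotpZl dotpZr -/a le_eqVlt; apply/orP; left; apply/eqP; field.
  by rewrite sn0.
rewrite -!expRD ler_expR /K.
have : (0 <= a / sigma ^+ 2)%R by rewrite divr_ge0// ltW.
have : (3 * C <= lambda * C)%R by rewrite ler_wpM2r.
lra.
Qed.

Lemma exp_moment_cross c :
  \int[P]_w (expR ((3 * sigma ^+ 2)^-1 * (2 * dotp c (noise eps w) - 2 / 3 * sqn c)))%:E = 1.
Proof.
have sn0 : (sigma != 0)%R by rewrite gt_eqF.
under eq_integral => w _.
  rewrite (_ : (3 * sigma ^+ 2)^-1 * _ = - (2 / 9 * (sqn c / sigma ^+ 2)) +
      dotp ((2 / (3 * sigma ^+ 2)) *: c) (noise eps w))%R; last first.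
    rewrite dotpZl; field.
    by rewrite sn0.
  rewrite expRD EFinM.
  over.
rewrite ge0_integralZl_EFin ?expR_ge0//; last first.
  apply/measurable_EFinP; apply: measurableT_comp => //; exact: measurable_dotp_noise.
rewrite (exp_moment_linear iid s0) -EFinM -expRD dotpZl dotpZr.
rewrite -[RHS](congr1 EFin (@expR0 R)); congr (expR _)%:E.
field.
by rewrite sn0.
Qed.

Let le_expR (k x : R) : (0 < k -> x <= k * expR (k^-1 * x))%R.
Proof.
move=> k0; rewrite -ler_pdivrMl//; have := expR_ge1Dx (k^-1 * x); lra.
Qed.

(** The cross term <c_J, e> of the fixed model is treated like the excess, by
    x <= k exp (x / k), so that all functions stay nonnegative. *)
Lemma risk_le_candidate J : @candidate n M J ->
  risk P X eps jhat mu <=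
  (20 * n%:R^-1 * (2 * sqn (bias J) + 2 * (rank_model X J)%:R * sigma ^+ 2
     + lambda * sigma ^+ 2 * @complexity R n M J + 6 * sigma ^+ 2))%:E.
Proof.
move=> cJ; rewrite /risk unlock.
set a := sqn (bias J); have a0 : (0 <= a)%R by exact: sqn_ge0.
set V := (2 * (rank_model X J)%:R * sigma ^+ 2 + lambda * sigma ^+ 2 * @complexity R n M J)%R.
have V0 : (0 <= V)%R.
  apply: addr_ge0; first by apply: (mulr_ge0 _ (ltW isq)); exact: mulr_ge0.
  apply: mulr_ge0; last exact: complexity_ge0.
  by apply: mulr_ge0; [have := lambda3; lra|exact: (ltW isq)].
pose s := [seq c <- index_enum _ | @candidate n M (model_of c)].
pose Ex J' w := expR ((3 * sigma ^+ 2)^-1 * excess J' (noise eps w)).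
pose E1 w := expR ((3 * sigma ^+ 2)^-1 * (2 * dotp (bias J) (noise eps w) - 2 / 3 * a)).
have n1 : (0 <= n%:R^-1 :> R)%R by rewrite invr_ge0.
have s3 : (0 < 3 * sigma ^+ 2)%R by rewrite mulr_gt0.
pose g w : \bar R := (20 * n%:R^-1)%:E * ((5 / 3 * a + V)%:E +
  (3 * sigma ^+ 2)%:E * ((E1 w)%:E + \sum_(c <- s) (Ex (model_of c) w)%:E)).
have mE1 : measurable_fun setT (fun w => (E1 w)%:E).
  apply/measurable_EFinP; apply: measurableT_comp => //; apply: measurable_funM => //.
  apply: measurable_funB => //; apply: measurable_funM => //; exact: measurable_dotp_noise.
have mEx J' : measurable_fun setT (fun w => (Ex J' w)%:E).
  apply/measurable_EFinP; apply: measurableT_comp => //; apply: measurable_funM => //.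
  apply: measurable_funB => //; apply: measurable_funB => //; apply: measurable_funB => //.
  by apply: measurable_funD; apply: measurable_funM => //;
    [exact: measurable_dotp_noise|exact: measurable_sqn_noise].
have S0 w : 0 <= \sum_(c <- s) (Ex (model_of c) w)%:E.
  by apply: sume_ge0 => c _; rewrite lee_fin expR_ge0.
apply: (@le_trans _ _ (\int[P]_w g w)).
  apply: ge0_le_integralT => w.
    by rewrite lee_fin normn2E mulr_ge0// sqn_ge0.
  have -> : g w = (20 * n%:R^-1 * (5 / 3 * a + V + 3 * sigma ^+ 2 *
      (E1 w + \sum_(c <- s) Ex (model_of c) w)))%:E by rewrite /g sumEFin.
  rewrite -/(noise eps w) lee_fin normn2E.
  rewrite [leRHS]mulrAC [leRHS]mulrC ler_wpM2l//.
  have := selected_loss_le (noise eps w) cJ.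
  set J' := jhat _ => /= H.
  have cJ' : @candidate n M J' by have [cand _ _] := sel; exact: cand.
  have [c cE] := model_ofP J'.
  have : (Ex J' w <= \sum_(c <- s) Ex (model_of c) w)%R.
    rewrite big_filter (bigD1 c)/= ?cE// lerDl.
    by apply: sumr_ge0 => *; exact: expR_ge0.
  move=> /(ler_wpM2l (ltW s3)).
  have := le_expR (excess J' (noise eps w)) s3.
  have := le_expR (2 * dotp (bias J) (noise eps w) - 2 / 3 * a)%R s3.
  rewrite -/(E1 w) -/(Ex J' w) -/a in H *.
  move: H; rewrite -[(_ + _ + 2 * _ * _)%R]addrA -/V.
  move: (\sum_(c <- s) _)%R (Ex J' w) (E1 w) => S x y.
  rewrite /V; lra.
have i0 w : 0 <= (E1 w)%:E + \sum_(c <- s) (Ex (model_of c) w)%:E.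
  by rewrite adde_ge0 ?lee_fin ?expR_ge0.
have k0 w : 0 <= (3 * sigma ^+ 2)%:E * ((E1 w)%:E + \sum_(c <- s) (Ex (model_of c) w)%:E).
  by rewrite mule_ge0 ?lee_fin ?(ltW s3).
have c0 : 0 <= (5 / 3 * a + V)%:E by rewrite lee_fin addr_ge0// mulr_ge0.
have mi : measurable_fun setT (fun w => (E1 w)%:E + \sum_(c <- s) (Ex (model_of c) w)%:E).
  by apply: emeasurable_funD => //; exact: emeasurable_sum.
rewrite /g ge0_integralZl_EFin//; last 2 first.
- by move=> w _; exact: adde_ge0.
- by apply: emeasurable_funD => //; exact: emeasurable_funM.
have -> : (2 * a + 2 * (rank_model X J)%:R * sigma ^+ 2 + lambda * sigma ^+ 2 * @complexity R n M J
   + 6 * sigma ^+ 2)%R = ((2 * a + V) + 3 * sigma ^+ 2 * (1 + 1))%R by rewrite /V; ring.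
rewrite [leRHS]EFinM lee_wpmul2l ?lee_fin ?mulr_ge0//.
rewrite ge0_integralD//; last exact: emeasurable_funM.
rewrite integral_cst//= probability_setT mule1 [leRHS]EFinD leeD//.
  by rewrite lee_fin lerD2r ler_wpM2r//; lra.
rewrite ge0_integralZl_EFin ?(ltW s3)//.
rewrite [leRHS]EFinM lee_wpmul2l ?lee_fin ?(ltW s3)//.
rewrite ge0_integralD//; last 2 first.
- by move=> w _; rewrite lee_fin expR_ge0.
- exact: emeasurable_sum.
rewrite exp_moment_cross [leRHS]EFinD leeD//.
rewrite ge0_integral_sum//; last by move=> c w _; rewrite lee_fin expR_ge0.
apply: (@le_trans _ _ (\sum_(c <- s) (expR (- @complexity R n M (model_of c)))%:E)).
  rewrite /s !big_filter; apply: lee_sum => c cc; exact: exp_moment_excess.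
by rewrite sumEFin lee_fin /s big_filter; exact: kraft.
Qed.

Local Close Scope ereal_scope.

Hypothesis r0 : (1 <= rank_model X full_model)%N.

Let n0R : (0 : R) < n%:R. Proof. by rewrite ltr0n. Qed.
Let bias0 J : 0 <= sqn (bias J). Proof. exact: sqn_ge0. Qed.
Local Notation rM := ((rank_model X full_model)%:R).
Let rM1 : 1 <= rM :> R. Proof. by rewrite ler1n. Qed.

Let risk_le_real (c D : R) : (risk P X eps jhat mu <= (20 * n%:R^-1 * D)%:E)%E ->
  20 * D <= c -> (risk P X eps jhat mu <= (n%:R^-1 * c)%:E)%E.
Proof.
move=> /le_trans h Dc; apply: h; rewrite lee_fin mulrAC mulrC ler_wpM2l// invr_ge0 ltW//.
Qed.

(** As rank X is at least 1, the term sigma^2 rank X also absorbs the constant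
    complexity of the full model. *)
Lemma risk_le_full :
  (risk P X eps jhat mu <=
   (n%:R^-1 * (440 * lambda * (sqn (bias full_model) + sigma ^+ 2 * rM)))%:E)%E.
Proof.
have cf : @candidate n M full_model by rewrite /= cardsT card_ord eqxx orbT.
apply: (risk_le_real (risk_le_candidate cf)).
have := bias0 full_model; set a := sqn _ => a0.
set r : R := (rank_model X full_model)%:R; have r1 : 1 <= r := rM1.
rewrite /= cardsT card_ord ltnn; set C := - ln (5 / 100); have C19 : C <= 19 := ln20_le.
have sr : sigma ^+ 2 <= sigma ^+ 2 * rM by rewrite ler_peMr// ltW.
set s2 := sigma ^+ 2 in sr *.
have h1 : 3 * a <= lambda * a by rewrite ler_wpM2r.
have h2 : 3 * (s2 * r) <= lambda * (s2 * r).
  by rewrite ler_wpM2r// mulr_ge0// ltW// (lt_le_trans ltr01).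
have h3 : lambda * s2 * C <= 19 * (lambda * (s2 * r)).
  rewrite mulrC; apply: (@le_trans _ _ (19 * (lambda * s2))).
    by rewrite ler_wpM2r// mulr_ge0// ?(ltW isq); have := lambda3; lra.
  by rewrite ler_wpM2l// ler_wpM2l//; have := lambda3; lra.
have := isq; rewrite -/s2; lra.
Qed.

Lemma risk_le_intercept :
  (risk P X eps jhat mu <=
   (n%:R^-1 * (440 * lambda * (sqn (bias Intercept) + sigma ^+ 2)))%:E)%E.
Proof.
apply: (risk_le_real (risk_le_candidate (J := Intercept) isT)).
have := bias0 Intercept; set a := sqn _ => a0.
rewrite /= mulr1; set C := - ln (5 / 100); have C19 : C <= 19 := ln20_le.
set s2 := sigma ^+ 2.
have h1 : 3 * a <= lambda * a by rewrite ler_wpM2r.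
have h2 : 3 * s2 <= lambda * s2 by rewrite ler_wpM2r// ltW.
have h3 : lambda * s2 * C <= 19 * (lambda * s2).
  by rewrite mulrC ler_wpM2r//; apply: mulr_ge0; [have := lambda3; lra|exact: (ltW isq)].
have := isq; rewrite -/s2; lra.
Qed.

Lemma risk_le_saturated :
  (risk P X eps jhat mu <= (440 * lambda * sigma ^+ 2)%:E)%E.
Proof.
rewrite -[_ * sigma ^+ 2](mulKf (lt0r_neq0 n0R)).
apply: (risk_le_real (risk_le_candidate (J := Saturated) isT)).
have -> : bias Saturated = 0 by rewrite /bias /= mulmx1 subrr.
rewrite dotp0l mulr0 /=; set C := - ln (5 / 100); have C19 : C <= 19 := ln20_le.
set s2 := sigma ^+ 2.
have n1 : (1 : R) <= n%:R by rewrite ler1n.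
have h0 : s2 <= n%:R * s2 by rewrite ler_peMl// ltW.
have h2 : 3 * (n%:R * s2) <= lambda * (n%:R * s2) by rewrite ler_wpM2r// mulr_ge0// ltW.
have h3 : lambda * s2 * C <= 19 * (lambda * (n%:R * s2)).
  rewrite mulrC; apply: (@le_trans _ _ (19 * (lambda * s2))).
    by rewrite ler_wpM2r// mulr_ge0// ?(ltW isq); have := lambda3; lra.
  by rewrite ler_wpM2l// ler_wpM2l//; have := lambda3; lra.
have := isq; rewrite -/s2; lra.
Qed.

(** Since ln C(M, |A|) >= 1/2 for a proper nonempty subset, this term absorbs the
    constants. *)
Lemma risk_le_subset (A : {set 'I_M}) : (1 <= #|A| <= minn M.-1 n)%N ->
  (risk P X eps jhat mu <=
   (n%:R^-1 * (440 * lambda * (sqn (bias (Subset A)) + sigma ^+ 2 * (rank_model X (Subset A))%:R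
     + sigma ^+ 2 * ln (minn M n)%:R + sigma ^+ 2 * ln 'C(M, #|A|)%:R)))%:E)%E.
Proof.
move=> hA.
have cA : @candidate n M (Subset A) by rewrite /= hA.
apply: (risk_le_real (risk_le_candidate cA)).
have := bias0 (Subset A); set a := sqn _ => a0.
set r := (rank_model _ _)%:R; have r0' : 0 <= r by exact: ler0n.
case/andP: hA => A1 AK.
have mA : (0 < minn M.-1 n)%N := leq_trans A1 AK.
have mK : (minn M.-1 n <= minn M n)%N.
  by rewrite leq_min geq_minr andbT (leq_trans (geq_minl _ _))// leq_pred.
have AM : (#|A| < M)%N.
  by rewrite (leq_ltn_trans (leq_trans AK (geq_minl _ _)))// ltn_predL (ltnW M2).
rewrite /= AM; set l := ln 'C(M, _)%:R; set lK := ln (minn M n)%:R.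
have l12 : 1 / 2 <= l.
  apply: le_trans (ln_bin_lb _); last by rewrite A1.
  by rewrite ler_peMr// ler1n leq_min A1 subn_gt0.
have hK : ln (minn M.-1 n)%:R <= lK.
  by rewrite ler_ln ?posrE ?ltr0n ?ler_nat ?(leq_trans mA).
have lK0 : 0 <= lK by rewrite ln_ge0// ler1n (leq_trans mA).
have h85 : - ln (85 / 100) <= 1 :> R.
  rewrite -lnV ?posrE; last lra.
  rewrite (_ : (85 / 100)^-1 = 1 + 15 / 85 :> R); last by field.
  apply: (@le_trans _ _ (15 / 85)); last lra.
  by apply: le_ln1Dx; lra.
set C := - ln (85 / 100) + _ + _.
have hC : C <= lK + 3 * l by rewrite /C; lra.
set s2 := sigma ^+ 2.
have h1 : 3 * a <= lambda * a by rewrite ler_wpM2r.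
have h2 : 3 * (s2 * r) <= lambda * (s2 * r) by rewrite ler_wpM2r// mulr_ge0// ltW.
have h3 : lambda * s2 * C <= lambda * s2 * lK + 3 * (lambda * s2 * l).
  have : 0 <= lambda * s2 by rewrite mulr_ge0 ?(ltW isq)//; have := lambda3; lra.
  by move=> /ler_wpM2l/(_ _ _ hC); lra.
have h4 : s2 * (1 / 2) <= s2 * l by rewrite ler_wpM2l// ltW.
have h5 : 3 * (s2 * l) <= lambda * (s2 * l).
  by rewrite ler_wpM2r//; apply: mulr_ge0; [exact: (ltW isq)|lra].
have h7 : 0 <= s2 * lK by exact: (mulr_ge0 (ltW isq)).
have h6 : 3 * (s2 * lK) <= lambda * (s2 * lK) by rewrite ler_wpM2r.
have h8 : 0 <= s2 * r by exact: (mulr_ge0 (ltW isq)).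
have := isq; rewrite -/s2; lra.
Qed.

Let weaken (c c' D D' : R) :
  (risk P X eps jhat mu <= (n%:R^-1 * (c * lambda * D))%:E)%E ->
  0 <= D -> 0 <= c -> c * D <= c' * D' ->
  (risk P X eps jhat mu <= (n%:R^-1 * (c' * lambda * D'))%:E)%E.
Proof.
move=> /le_trans h D0 c0 H; apply: h; rewrite lee_fin.
apply: ler_wpM2l; first by rewrite invr_ge0 ltW.
rewrite (mulrAC c) (mulrAC c') ler_wpM2r//; have := lambda3; lra.
Qed.

Lemma risk_le_any_subset (A : {set 'I_M}) : (1 <= #|A| < M)%N ->
  (risk P X eps jhat mu <=
   (n%:R^-1 * (880 * lambda * (sqn (bias full_model) +
     (sqn (mu *m proj_mat X (Subset A) - mu *m proj_mat X full_model)
      + sigma ^+ 2 * (rank_model X (Subset A))%:R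
     + sigma ^+ 2 * ln (minn M n)%:R + sigma ^+ 2 * ln 'C(M, #|A|)%:R))))%:E)%E.
Proof.
move=> hA; have /andP[A1 AM] := hA.
have lC0 : 0 <= ln 'C(M, #|A|)%:R :> R by apply: ln_bin_ge0; exact: ltnW.
have lK0 : 0 <= ln (minn M n)%:R :> R.
  by rewrite ln_ge0// ler1n leq_min n0 andbT (leq_trans _ M2).
set lC := ln _ in lC0 *; set lK := ln _ in lK0 *.
have a0 := bias0 full_model.
have b0 := sqn_ge0 (mu *m proj_mat X (Subset A) - mu *m proj_mat X full_model).
set r : R := (rank_model _ _)%:R; have r0' : 0 <= r by exact: ler0n.
have p1 := mulr_ge0 (ltW isq) lC0; have p2 := mulr_ge0 (ltW isq) lK0.
have p3 := mulr_ge0 (ltW isq) r0'.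
have [nA|An] := ltnP n #|A|.
  apply: (weaken risk_le_full).
  - by rewrite addr_ge0// mulr_ge0// ltW.
  - exact: ler0n.
  have := full_rank_le_noncandidate X hA nA.
  rewrite rank_model_full -/lC -[(\rank (design X A))%:R]/r.
  move=> /(ler_wpM2l (ltW isq)); lra.
have hA' : (1 <= #|A| <= minn M.-1 n)%N.
  by rewrite A1 leq_min An andbT -ltnS prednK// (leq_trans _ M2).
apply: (weaken (risk_le_subset hA')).
- by rewrite -/lC -/lK !addr_ge0.
- exact: ler0n.
- rewrite {1}/bias sqn_proj_full -/(bias full_model) -/lC -/lK -/r; lra.
Qed.

Lemma risk_le_range : (mu <= X^T)%MS ->
  (risk P X eps jhat mu <=
    (440 * lambda * (sigma ^+ 2 * (rank_model X full_model)%:R / n%:R))%:E)%E.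
Proof.
move=> hmu; have := risk_le_full.
have -> : bias full_model = 0.
  by rewrite /bias proj_in_range ?subrr// (submx_trans hmu)// design_full.
by rewrite dotp0l add0r mulrCA [n%:R^-1 * _]mulrC.
Qed.

(** For k within the candidate range, a subset of size k containing the support of
    theta is used; ln C(M, k), ln (min (M, n)) and the rank are all at most
    k (1 + ln (M / k)).  Beyond that range rank X <= k, and the full model serves. *)
Lemma risk_le_sparse k (theta : 'rV[R]_M) : (1 <= k <= M)%N -> (norm0 theta <= k)%N ->
  (risk P X eps jhat mu <=
   (n%:R^-1 * (1320 * lambda * (sqn (mu - theta *m X^T) +
       sigma ^+ 2 * (k%:R * (1 + ln (M%:R / k%:R))))))%:E)%E.
Proof.
move=> /[dup] kM /andP[k1 kM'] tk.
have k0R : (1 : R) <= k%:R by rewrite ler1n.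
have kMR : (k%:R : R) <= M%:R by rewrite ler_nat.
have lMk : 0 <= ln (M%:R / k%:R) :> R.
  by rewrite ln_ge0// ler_pdivlMr ?mul1r// (lt_le_trans ltr01).
set l := ln (M%:R / k%:R) in lMk *.
have kl : k%:R <= k%:R * (1 + l) by rewrite ler_peMr ?(le_trans ler01)//; lra.
have b0 := sqn_ge0 (mu - theta *m X^T).
have [kK|Kk] := leqP k (minn M.-1 n); last first.
  apply: (weaken risk_le_full).
  - by rewrite addr_ge0// mulr_ge0// ltW.
  - exact: ler0n.
  have H1 : sqn (bias full_model) <= sqn (mu - theta *m X^T).
    by apply: sqn_proj_le; apply: submx_trans (design_full X); exact: submxMl.
  have : (rank_model X full_model)%:R <= k%:R * (1 + l) :> R.
    apply: le_trans kl; rewrite ler_nat rank_model_full.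
    have := rank_full_le X; rewrite leq_min => /andP[h1 h2].
    move: Kk; rewrite gtn_min => /orP[|/ltnW]; last exact: leq_trans.
    by rewrite prednK ?(ltnW M2)//; exact: leq_trans.
  move=> /(ler_wpM2l (ltW isq)).
  have : 0 <= sigma ^+ 2 * (rank_model X full_model)%:R by rewrite mulr_ge0// ltW.
  lra.
have [A SA Ak] := @superset_card M k [set j | theta ord0 j != 0]%SET
  (introT andP (conj tk kM')).
have H1 : sqn (bias (Subset A)) <= sqn (mu - theta *m X^T).
  apply: sqn_proj_le; apply: supp_sub_design => j tj.
  by apply: (fintype.subsetP SA); rewrite inE.
have hA : (1 <= #|A| <= minn M.-1 n)%N by rewrite Ak k1.
have kMlt : (k < M)%N.
  by rewrite (leq_ltn_trans (leq_trans kK (geq_minl _ _)))// ltn_predL (ltnW M2).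
have lC0 : 0 <= ln 'C(M, k)%:R :> R by apply: ln_bin_ge0.
have lK0 : 0 <= ln (minn M n)%:R :> R.
  by rewrite ln_ge0// ler1n leq_min n0 andbT (leq_trans _ M2).
have lKk : ln (minn M n)%:R <= k%:R * (1 + l).
  apply: (@le_trans _ _ (ln M%:R)).
    by rewrite ler_ln ?posrE ?ltr0n ?leq_min ?n0 ?(ltnW M2)// ler_nat geq_minl.
  have -> : M%:R = k%:R * (M%:R / k%:R) :> R.
    by rewrite mulrC divfK// gt_eqF// (lt_le_trans ltr01).
  have k0 : 0 < k%:R :> R by exact: lt_le_trans ltr01 _.
  rewrite lnM ?posrE ?divr_gt0 ?(lt_le_trans k0)// -/l mulrDr mulr1.
  apply: lerD; first by exact/ltW/ln_sublinear.
  by rewrite ler_peMl.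
have lCk := @ln_bin_le R M k kM; rewrite -/l in lCk.
have rk : (rank_model X (Subset A))%:R <= k%:R * (1 + l) :> R.
  by apply: le_trans kl; rewrite ler_nat /= -Ak rank_leq_col.
apply: (weaken (risk_le_subset hA)).
- by rewrite !addr_ge0 ?sqn_ge0 ?Ak//; apply: mulr_ge0; rewrite ?(ltW isq)//.
- exact: ler0n.
rewrite Ak.
move: rk lCk lKk => /(ler_wpM2l (ltW isq)) h1 /(ler_wpM2l (ltW isq)) h2 /(ler_wpM2l (ltW isq)) h3.
lra.
Qed.
End Oracle.

(** * Sparse approximation on l_q balls *)

Section Norm0.
Context {R : realType} {M : nat}.
Implicit Types u v : 'rV[R]_M.

Lemma norm0D u v : (norm0 (u + v) <= norm0 u + norm0 v)%N.
Proof.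
rewrite /norm0 (leq_trans _ (leq_card_setU _ _))//; apply: subset_leq_card.
apply/fintype.subsetP => j; rewrite !inE mxE; apply: contraNT.
by rewrite negb_or !negbK => /andP[/eqP-> /eqP->]; rewrite addr0.
Qed.

Lemma norm0Z a u : (norm0 (a *: u) <= norm0 u)%N.
Proof.
apply: subset_leq_card; apply/fintype.subsetP => j; rewrite !inE mxE.
by apply: contraNN => /eqP ->; rewrite mulr0.
Qed.

Lemma norm0_delta (j : 'I_M) : norm0 (delta_mx ord0 j : 'rV[R]_M) = 1%N.
Proof.
transitivity #|[set j]%SET|; last exact: cards1.
apply: eq_card => i; rewrite !inE mxE eqxx/=.
by case: (i == j); rewrite ?oner_eq0 ?eqxx.
Qed.

Lemma norm00 : norm0 (0 : 'rV[R]_M) = 0%N.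
Proof. by apply: eq_card0 => i; rewrite !inE mxE eqxx. Qed.

End Norm0.

(** |x| = |x|^q |x|^(1-q). *)
Lemma sum_norm_le {R : realType} {M : nat} (q tau : R) (v : 'rV[R]_M) : q <= 1 ->
  0 <= tau -> (forall j, `|v ord0 j| <= tau) ->
  \sum_j `|v ord0 j| <= (\sum_j `|v ord0 j| `^ q) * tau `^ (1 - q).
Proof.
move=> q1 tau0 h; rewrite big_distrl/=; apply: ler_sum => j _.
have [->|vj0] := eqVneq (v ord0 j) 0.
  by rewrite normr0 mulr_ge0 ?powR_ge0.
rewrite -[leLHS]powRr1// -[X in _ `^ X](subrKC q) powRD; last first.
  by rewrite normr_eq0 vj0 implybT.
by rewrite ler_wpM2l ?powR_ge0// ge0_ler_powR ?nnegrE ?subr_ge0.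
Qed.

Lemma sum_powR_le {R : realType} {M : nat} (q t : R) (theta : 'rV[R]_M) : 0 < q ->
  0 < t -> Defs.normq q theta <= t -> \sum_j `|theta ord0 j| `^ q <= t `^ q.
Proof.
move=> q0 t0 hq.
have S0 : 0 <= \sum_j `|theta ord0 j| `^ q by apply: sumr_ge0 => j _; exact: powR_ge0.
have : Defs.normq q theta `^ q <= t `^ q.
  by rewrite ge0_ler_powR ?nnegrE ?powR_ge0 ?(ltW q0) ?(ltW t0).
by rewrite /Defs.normq -powRrM mulVf ?gt_eqF// powRr1.
Qed.

Lemma norm1_le_normq {R : realType} {M : nat} (q t : R) (theta : 'rV[R]_M) : 0 < q <= 1 ->
  0 < t -> Defs.normq q theta <= t -> \sum_j `|theta ord0 j| <= t.
Proof.
move=> /andP[q0 q1] t0 hq; have St := sum_powR_le q0 t0 hq.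
have tj j : `|theta ord0 j| <= t.
  rewrite leNgt; apply/negP => tj.
  have : t `^ q < `|theta ord0 j| `^ q by rewrite gt0_ltr_powR ?nnegrE ?(ltW t0).
  rewrite ltNge; apply/negP; rewrite negbK; apply: le_trans St.
  rewrite (bigD1 j)//= lerDl; apply: sumr_ge0 => i _; exact: powR_ge0.
apply: (le_trans (sum_norm_le q1 (ltW t0) tj)).
apply: (@le_trans _ _ (t `^ q * t `^ (1 - q))); first by rewrite ler_wpM2r ?powR_ge0.
by rewrite -powRD ?subrKC ?powRr1 ?(ltW t0)// (gt_eqF t0) implybT.
Qed.

Section Maurey.
Context {R : realType} {n M : nat} (X : 'M[R]_(n, M)) (c : R).
Hypothesis Xc : forall j, sqn (row j X^T) <= c.

(** Drawing column j with probability |theta_j| / rho, the vector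
    rho sgn(theta_j) x_j has mean X theta and squared norm at most rho^2 c; the
    inequality is the resulting bound on the mean squared distance to u,
    multiplied by rho. *)
Lemma maurey_average (theta : 'rV[R]_M) (rho : R) (u : 'rV[R]_n) :
  rho = \sum_j `|theta ord0 j| ->
  \sum_j `|theta ord0 j| * sqn (u - (rho * Num.sg (theta ord0 j)) *: row j X^T)
    <= rho * (sqn u - 2 * dotp u (theta *m X^T) + rho ^+ 2 * c).
Proof.
move=> rhoE.
have dE : dotp u (theta *m X^T) = \sum_j theta ord0 j * dotp u (row j X^T).
  rewrite mulmx_sum_row; elim/big_rec2: _ => [|j x y _ <-]; first by rewrite dotp0r.
  by rewrite dotpDr dotpZr.
apply: (@le_trans _ _ (\sum_j (`|theta ord0 j| * (sqn u + rho ^+ 2 * c)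
     - 2 * rho * (theta ord0 j * dotp u (row j X^T))))); last first.
  by rewrite sumrB -big_distrl -big_distrr/= -rhoE -dE; lra.
apply: ler_sum => j _.
set t := theta ord0 j; set x := row j X^T.
have tn : `|t| * Num.sg t = t by rewrite mulrC -numEsg.
have ts : `|t| * Num.sg t ^+ 2 = `|t| by rewrite expr2 mulrA tn mulrC -normrEsg.
have -> : sqn (u - (rho * Num.sg t) *: x) =
    sqn u - 2 * rho * Num.sg t * dotp u x + Num.sg t ^+ 2 * (rho ^+ 2 * sqn x).
  by rewrite sqnD dotpNr dotpNl dotpNr dotpZl !dotpZr; ring.
have -> : `|t| * (sqn u - 2 * rho * Num.sg t * dotp u x + Num.sg t ^+ 2 * (rho ^+ 2 * sqn x)) =
    `|t| * sqn u - 2 * rho * (`|t| * Num.sg t * dotp u x)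
    + `|t| * Num.sg t ^+ 2 * (rho ^+ 2 * sqn x).
  by ring.
rewrite tn ts.
have : `|t| * (rho ^+ 2 * sqn x) <= `|t| * (rho ^+ 2 * c).
  by rewrite ler_wpM2l// ler_wpM2l ?sqr_ge0//; exact: Xc.
lra.
Qed.

(** The average of [maurey_average] at u = X theta is nonnegative. *)
Lemma sqn_combo_le (theta : 'rV[R]_M) (rho : R) : rho = \sum_j `|theta ord0 j| ->
  sqn (theta *m X^T) <= rho ^+ 2 * c.
Proof.
move=> rhoE; have : 0 <= rho by rewrite rhoE sumr_ge0.
rewrite le_eqVlt => /orP[/eqP rho0|rho0].
  have -> : theta = 0.
    apply/rowP => j; rewrite mxE; apply/eqP; rewrite -normr_eq0; apply/eqP.
    by apply: (psumr_eq0P _ (esym (etrans rho0 rhoE))).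
  by rewrite mul0mx dotp0l -rho0 expr0n mul0r.
have := maurey_average (theta *m X^T) rhoE.
move=> /(le_trans (sumr_ge0 _ (fun j _ => mulr_ge0 (normr_ge0 _) (sqn_ge0 _)))).
rewrite pmulr_rge0//; lra.
Qed.

(** Some draw does at least as well as the average at u = e + X theta. *)
Lemma maurey_step (theta : 'rV[R]_M) (rho : R) (e : 'rV[R]_n) :
  rho = \sum_j `|theta ord0 j| -> 0 < rho ->
  exists j, sqn (e + theta *m X^T - (rho * Num.sg (theta ord0 j)) *: row j X^T)
     <= sqn e + rho ^+ 2 * c.
Proof.
move=> rhoE rho0; apply: contrapT => /forallNP H.
set V := theta *m X^T in H.
pose D j := sqn (e + V - (rho * Num.sg (theta ord0 j)) *: row j X^T) - (sqn e + rho ^+ 2 * c).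
have D0 j : 0 < D j by rewrite subr_gt0 ltNge; apply/negP/H.
have sum_le0 : \sum_j `|theta ord0 j| * D j <= 0.
  under eq_bigr do rewrite mulrBr.
  rewrite sumrB -big_distrl/= -rhoE subr_le0.
  apply: (le_trans (maurey_average (e + V) rhoE)); rewrite ler_wpM2l ?(ltW rho0)//.
  rewrite -/V sqnD dotpDl; have := sqn_ge0 V; lra.
have p0 j : 0 <= `|theta ord0 j| * D j by rewrite mulr_ge0// ltW.
have /psumr_eq0P z : \sum_j `|theta ord0 j| * D j = 0.
  by apply/eqP; rewrite eq_le sum_le0 sumr_ge0.
move: rho0; rewrite rhoE big1 ?ltxx// => j _.
have /eqP := z (fun j _ => p0 j) j isT.
by rewrite mulf_eq0 (gt_eqF (D0 j)) orbF => /eqP.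
Qed.

(** k draws chosen greedily: the accumulated error k X theta - X eta has squared
    norm growing by at most rho^2 c at each step. *)
Lemma maurey (theta : 'rV[R]_M) (rho : R) k : rho = \sum_j `|theta ord0 j| ->
  exists2 eta : 'rV[R]_M, (norm0 eta <= k)%N &
    sqn ((k%:R *: theta - eta) *m X^T) <= k%:R * (rho ^+ 2 * c).
Proof.
move=> rhoE.
have rho0 : 0 <= rho by rewrite rhoE sumr_ge0.
move: rho0; rewrite le_eqVlt => /orP[/eqP rho0|rho0].
  have -> : theta = 0.
    apply/rowP => j; rewrite mxE; apply/eqP; rewrite -normr_eq0; apply/eqP.
    by apply: (psumr_eq0P _ (esym (etrans rho0 rhoE))).
  exists 0; first by rewrite norm00.
  by rewrite scaler0 subrr mul0mx dotp0l -rho0 expr0n mul0r mulr0.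
elim: k => [|k [eta e0 ek]].
  by exists 0; rewrite ?norm00// scale0r subrr mul0mx dotp0l mul0r.
have [j hj] := maurey_step ((k%:R *: theta - eta) *m X^T) rhoE rho0.
exists (eta + (rho * Num.sg (theta ord0 j)) *: delta_mx ord0 j).
  rewrite (leq_trans (norm0D _ _))// -[k.+1]addn1 leq_add// (leq_trans (norm0Z _ _))//.
  by rewrite norm0_delta.
have -> : (k.+1%:R *: theta - (eta + (rho * Num.sg (theta ord0 j)) *: delta_mx ord0 j)) *m X^T =
   (k%:R *: theta - eta) *m X^T + theta *m X^T - (rho * Num.sg (theta ord0 j)) *: row j X^T.
  rewrite rowE scalemxAl -mulmxDl -mulmxBl; congr (_ *m _).
  by rewrite -natr1 scalerDl scale1r opprD addrA [_ + theta - eta]addrAC.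
apply: le_trans hj _; rewrite -natr1 mulrDl mul1r; lra.
Qed.

Hypothesis c0 : 0 <= c.

(** The coefficients larger than tau = t k^(-1/q) number at most k, because their
    q-th powers sum to at most t^q.  The others have l_1 norm at most
    t^q tau^(1-q) = t k^(1 - 1/q), and Maurey's argument with k draws
    approximates their contribution within c (t k^(1 - 1/q))^2 / k. *)
Lemma sparse_approx (q t : R) (theta : 'rV[R]_M) k : 0 < q <= 1 -> 0 < t -> (0 < k)%N ->
  Defs.normq q theta <= t ->
  exists2 theta' : 'rV[R]_M, (norm0 theta' <= k.*2)%N &
    sqn ((theta - theta') *m X^T) <= c * (t ^+ 2 * k%:R `^ (1 - 2 / q)).
Proof.
move=> /andP[q0 q1] t0 k0 hq.
have k0R : 0 < k%:R :> R by rewrite ltr0n.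
pose tau := t * k%:R `^ (- q^-1).
have tau0 : 0 < tau by rewrite mulr_gt0// powR_gt0.
have tauq : tau `^ q = t `^ q / k%:R.
  rewrite powRM ?powR_ge0 ?ltW// -powRrM mulNr mulVf ?gt_eqF// powR_inv1//.
pose S := \sum_j `|theta ord0 j| `^ q.
have St : S <= t `^ q by exact: sum_powR_le.
pose A := [set j : 'I_M | tau < `|theta ord0 j|]%SET.
pose tA : 'rV[R]_M := \row_j (if j \in A then theta ord0 j else 0).
pose tB := theta - tA.
have tBE j : tB ord0 j = if j \in A then 0 else theta ord0 j.
  by rewrite !mxE; case: ifP => _; rewrite ?subrr ?subr0.
have Ak : (#|A| <= k)%N.
  have : #|A|%:R * tau `^ q <= S.
    rewrite mulr_natl -sumr_const [leLHS]big_mkcond/=; apply: ler_sum => j _.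
    case: ifP => [|_]; last exact: powR_ge0.
    rewrite inE => /ltW h; rewrite ge0_ler_powR ?nnegrE ?(ltW q0) ?(ltW tau0)//.
  move=> /le_trans/(_ St); rewrite tauq mulrCA ger_pMr ?powR_gt0//.
  by rewrite ler_pdivrMr// mul1r ler_nat.
pose rho := \sum_j `|tB ord0 j|.
have rho0 : 0 <= rho by apply: sumr_ge0.
have hrho : rho <= t * k%:R `^ (1 - q^-1).
  have tBtau j : `|tB ord0 j| <= tau.
    rewrite tBE; case: ifPn => [_|]; first by rewrite normr0 ltW.
    by rewrite inE -leNgt.
  have : rho <= S * tau `^ (1 - q).
    apply: (le_trans (sum_norm_le q1 (ltW tau0) tBtau)).
    rewrite ler_wpM2r ?powR_ge0//; apply: ler_sum => j _; rewrite tBE.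
    by case: ifP => // _; rewrite normr0 powR0 ?powR_ge0 ?gt_eqF.
  move=> /le_trans; apply.
  apply: (@le_trans _ _ (t `^ q * tau `^ (1 - q))); first by rewrite ler_wpM2r ?powR_ge0.
  rewrite powRM ?powR_ge0 ?(ltW t0)// mulrA -powRD; last by rewrite (gt_eqF t0) implybT.
  rewrite subrKC powRr1 ?(ltW t0)// -powRrM.
  have E : - q^-1 * (1 - q) = 1 - q^-1 by field; rewrite gt_eqF.
  by rewrite E.
have [eta e0 ek] := maurey k (erefl rho : rho = \sum_j `|tB ord0 j|).
exists (tA + k%:R^-1 *: eta).
  rewrite (leq_trans (norm0D _ _))// -addnn leq_add//.
    rewrite (leq_trans _ Ak)//; apply: subset_leq_card; apply/fintype.subsetP => j.
    by rewrite inE mxE; case: ifP => //; rewrite eqxx.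
  by rewrite (leq_trans (norm0Z _ _)).
have -> : theta - (tA + k%:R^-1 *: eta) = k%:R^-1 *: (k%:R *: tB - eta).
  by rewrite scalerBr scalerA mulVf ?gt_eqF// scale1r /tB opprD addrA.
rewrite -scalemxAl dotpZl dotpZr.
apply: (@le_trans _ _ (k%:R^-1 * (k%:R^-1 * (k%:R * (rho ^+ 2 * c))))).
  by rewrite ler_pM2l ?invr_gt0// ler_pM2l ?invr_gt0.
have -> : k%:R^-1 * (k%:R^-1 * (k%:R * (rho ^+ 2 * c))) = c * (rho ^+ 2 / k%:R).
  by field; rewrite gt_eqF.
rewrite ler_wpM2l// ler_pdivrMr//.
apply: (@le_trans _ _ ((t * k%:R `^ (1 - q^-1)) ^+ 2)).
  by rewrite lerXn2r ?nnegrE// mulr_ge0 ?powR_ge0// ltW.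
rewrite exprMn -[leRHS]mulrA ler_wpM2l ?sqr_ge0//.
rewrite -powR_mulrn ?powR_ge0// -powRrM.
have -> : (1 - q^-1) * 2 = 1 - 2 / q + 1 by field; rewrite gt_eqF.
rewrite powRD; last by rewrite (gt_eqF k0R) implybT.
by rewrite powRr1// ltW.
Qed.
End Maurey.

(** * Balancing approximation error and model dimension *)

Section Rate.
Context {R : realType}.

Lemma absz_ceil_itv (x : R) : 0 <= x -> x <= `|Num.ceil x|%N%:R < x + 1.
Proof.
move=> x0.
have c0 : (0 <= Num.ceil x)%R by rewrite ceil_ge0; apply: lt_le_trans x0; rewrite ltrN10.
have -> : `|Num.ceil x|%N%:R = (Num.ceil x)%:~R :> R by rewrite natr_absz ger0_norm.
have /andP[h1 h2] := ceil_itv x; rewrite h2/=.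
by move: h1; rewrite intrD intrN; lra.
Qed.

Lemma powRV (x a : R) : 0 <= x -> x^-1 `^ a = x `^ (- a).
Proof. by move=> x0; rewrite -powR_inv1// -powRrM mulN1r. Qed.

Variables (n M : nat) (sigma q t : R).
Hypotheses (n0 : (0 < n)%N) (s0 : 0 < sigma) (q0 : 0 < q) (q1 : q <= 1) (t0 : 0 < t).
Let E := eff_dim n sigma q t.
Let L := 1 + ln (M%:R / E).
Let W : R := n%:R * t ^+ 2 * sigma ^- 2.
Let n0R : (0 : R) < n%:R. Proof. by rewrite ltr0n. Qed.
Let W0 : 0 < W. Proof. by rewrite !mulr_gt0 ?exprn_gt0 ?invr_gt0 ?exprn_gt0. Qed.
Let E0 : 0 < E. Proof. exact: powR_gt0. Qed.

Lemma rate_mid_eq : 0 < L ->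
  sigma `^ (2 - q) * t `^ q * (L / n%:R) `^ (1 - q / 2) =
  n%:R^-1 * (sigma ^+ 2 * (E * L `^ (1 - q / 2))).
Proof.
move=> L0.
have EE : E = n%:R `^ (q / 2) * t `^ q * sigma `^ (- q).
  have t2 : (t ^+ 2) `^ (q / 2) = t `^ q.
    by rewrite -powR_mulrn ?(ltW t0)// -powRrM; congr (_ `^ _); field.
  have s2 : (sigma ^- 2) `^ (q / 2) = sigma `^ (- q).
    rewrite powRV ?sqr_ge0// -powR_mulrn ?(ltW s0)// -powRrM.
    by congr (_ `^ _); field.
  have s2i : 0 <= sigma ^- 2 by rewrite invr_ge0 sqr_ge0.
  rewrite /E /eff_dim (powRM _ (mulr_ge0 (ltW n0R) (sqr_ge0 t)) s2i) s2.
  by rewrite (powRM _ (ltW n0R) (sqr_ge0 t)) t2.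
rewrite EE powRM ?invr_ge0 ?(ltW L0) ?(ltW n0R)// powRV ?(ltW n0R)//.
rewrite powRD; last by rewrite (gt_eqF s0) implybT.
rewrite powR_mulrn ?(ltW s0)//.
have -> : n%:R `^ (- (1 - q / 2)) = n%:R^-1 * n%:R `^ (q / 2) :> R.
  rewrite opprB addrC powRD; last by rewrite (gt_eqF n0R) implybT.
  by rewrite powR_inv1// ltW.
ring.
Qed.

(** The dimension, before rounding up, that equates the two error terms. *)
Let mt : R := E * L `^ (- (q / 2)).

Let mtL : 0 < L -> mt * L = E * L `^ (1 - q / 2).
Proof.
move=> L0; rewrite /mt -mulrA; congr (_ * _).
rewrite -[X in _ * X]powRr1 ?(ltW L0)// -powRD ?(gt_eqF L0) ?implybT//.
by rewrite addrC.
Qed.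

Let mt_pow : 0 < L -> n%:R * t ^+ 2 * mt `^ (1 - 2 / q) = sigma ^+ 2 * (E * L `^ (1 - q / 2)).
Proof.
move=> L0; rewrite /mt powRM ?powR_ge0 ?(ltW E0)// -powRrM.
have -> : - (q / 2) * (1 - 2 / q) = 1 - q / 2 by field; rewrite gt_eqF.
have -> : E `^ (1 - 2 / q) = E * W^-1.
  rewrite powRD ?(gt_eqF E0) ?implybT// powRr1 ?(ltW E0)//; congr (_ * _).
  rewrite /E /eff_dim -/W -powRrM (_ : q / 2 * - (2 / q) = -1).
    by rewrite powR_inv1// ltW.
  by field; rewrite gt_eqF.
rewrite /W; field.
by rewrite !gt_eqF.
Qed.

(** k is [mt] rounded up.  The condition 1 < m_low gives [1 / 4 <= mt], so rounding
    costs a factor at most 5; and k <= m_up <= M because mt <= E. *)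
Lemma rate_mid : (1 < m_low n M sigma q t < minn M n)%N ->
  0 < L /\ exists k : nat, [/\ (0 < k <= M)%N,
    n%:R * t ^+ 2 * k%:R `^ (1 - 2 / q) <= sigma ^+ 2 * (E * L `^ (1 - q / 2)) &
    k%:R * (1 + ln (M%:R / k%:R)) <= 10 * (E * L `^ (1 - q / 2))].
Proof.
rewrite /m_low; set m := m_up n M sigma q t.
case: ifPn => [/eqP ->|mMn]; first by rewrite ltnn andbF.
set a := `|Num.ceil E|%N.
have ma : m = a.
  move: mMn; rewrite /m /m_up -/E -/a -minnA.
  by case: (leqP a (minn M n)) => h; rewrite ?eqxx.
have aMn : (a < minn M n)%N.
  move: mMn; rewrite -ma /m /m_up -/E -/a -minnA ltn_neqAle geq_minr andbT.
  by [].
have aM : (a < M)%N by apply: leq_trans aMn (geq_minl _ _).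
have /andP[Ea aE] : E <= a%:R < E + 1 by apply: absz_ceil_itv; exact: ltW.
rewrite ma => /andP[h1 _].
have a0 : (0 < a%:R :> R) by exact: lt_le_trans Ea.
have M0 : (0 < M%:R :> R) by rewrite ltr0n (leq_ltn_trans _ aM).
set La : R := 1 + ln (M%:R / a%:R) in h1.
have La1 : 1 <= La.
  by rewrite lerDl ln_ge0// ler_pdivlMr// mul1r ler_nat ltnW.
have La0 : 0 < La by exact: lt_le_trans La1.
have big1 : 1 < a%:R / La `^ (q / 2).
  rewrite ltNge; apply/negP => h.
  have x0 : 0 <= a%:R / La `^ (q / 2) by rewrite divr_ge0 ?powR_ge0 ?(ltW a0).
  have : (`|Num.ceil (a%:R / La `^ (q / 2))|%N <= 1)%N.
    have := absz_ceil_itv x0 => /andP[_ hh].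
    rewrite -ltnS -(ltr_nat R); apply: lt_le_trans hh _; lra.
  by rewrite leqNgt h1.
have q21 : q / 2 <= 1 by move: q1; lra.
have q2 : 0 <= q / 2 by rewrite divr_ge0 ?(ltW q0).
have Lp1 : 1 <= La `^ (q / 2) by rewrite -[leLHS](powRr0 La) ler_powR.
have a1 : 1 < a%:R :> R.
  apply: lt_le_trans big1 _; rewrite ler_pdivrMr ?(lt_le_trans ltr01)//.
  by rewrite ler_peMr// ltW.
have a2 : 2 <= a%:R :> R by move: a1; rewrite ltr1n (ler_nat R 2).
have E1 : 1 < E by lra.
have aE2 : a%:R <= 2 * E by lra.
have lME : 0 <= ln (M%:R / E).
  rewrite ln_ge0// ler_pdivlMr// mul1r (le_trans Ea)// ler_nat ltnW//.
have L1 : 1 <= L by rewrite /L; lra.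
have L0 : 0 < L by exact: lt_le_trans L1.
split=> //.
have mt0 : 0 < mt by rewrite mulr_gt0// powR_gt0.
have mtE : mt <= E.
  rewrite /mt ler_piMr ?(ltW E0)// powRN invf_le1 ?powR_gt0//.
  by rewrite -[leLHS](powRr0 L) ler_powR.
(* E and its ceiling a are within a factor 2, so L and La are comparable *)
have LLa : L <= 2 * La.
  have : ln (M%:R / E) <= ln 2 + ln (M%:R / a%:R).
    rewrite -lnM ?posrE ?divr_gt0// ler_ln ?posrE ?mulr_gt0 ?invr_gt0//.
    rewrite ler_pdivrMr// (_ : 2 * (M%:R / a%:R) * E = 2 * M%:R * E / a%:R); last by ring.
    rewrite ler_pdivlMr//.
    by have := ler_wpM2l (ltW M0) aE2; lra.
  have : ln 2 <= 1 :> R.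
    by rewrite (_ : 2 = 1 + 1)// le_ln1Dx// ltrN10.
  have : 0 <= ln (M%:R / a%:R) :> R by rewrite /La in La1; lra.
  rewrite /L /La; lra.
have mt4 : 1 / 4 <= mt.
  have p2 : 2 `^ (q / 2) <= 2 :> R.
    by rewrite -[leRHS]powRr1// ler_powR// ler1n.
  have LL : L `^ (q / 2) <= 2 * La `^ (q / 2).
    apply: (@le_trans _ _ ((2 * La) `^ (q / 2))).
      have La2 : 0 <= 2 * La by lra.
      by rewrite ge0_ler_powR ?nnegrE ?(ltW L0).
    by rewrite powRM ?(ltW La0)// ler_wpM2r ?powR_ge0.
  have LaA : La `^ (q / 2) < a%:R by move: big1; rewrite ltr_pdivlMr ?mul1r ?powR_gt0.
  rewrite /mt powRN ler_pdivlMr ?powR_gt0//; lra.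
pose k := `|Num.ceil mt|%N; exists k.
have /andP[mk km] : mt <= k%:R < mt + 1 by apply: absz_ceil_itv; exact: ltW.
have k0R : (0 < k%:R :> R) by exact: lt_le_trans mk.
have ka : (k <= a)%N.
  by rewrite -ltnS -(ltr_nat R) -natr1; lra.
split.
- by rewrite -(ltr0n R) k0R (leq_trans ka)// ltnW.
- have nt : 0 <= n%:R * t ^+ 2 := mulr_ge0 (ltW n0R) (sqr_ge0 t).
  rewrite -mt_pow//; apply: (ler_wpM2l nt).
  have ex : 1 - 2 / q = - (2 / q - 1) by rewrite opprB.
  rewrite ex !powRN lef_pV2 ?posrE ?powR_gt0//.
  rewrite ge0_ler_powR ?nnegrE ?(ltW mt0) ?(ltW k0R)//.
  rewrite subr_ge0 ler_pdivlMr// mul1r; move: q1; lra.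
- rewrite -mtL//.
  have lk : ln (M%:R / k%:R) <= ln (M%:R / mt).
    rewrite ler_ln ?posrE ?divr_gt0// ler_wpM2l ?(ltW M0)// lef_pV2 ?posrE//.
  have lmt : ln (M%:R / mt) = ln (M%:R / E) + q / 2 * ln L.
    rewrite -ln_powR -lnM ?posrE ?divr_gt0 ?powR_gt0//; congr ln.
    by rewrite /mt powRN invfM invrK mulrA.
  have lL : q / 2 * ln L <= L.
    have l0 : 0 <= ln L by rewrite ln_ge0.
    have lL : ln L <= L by exact/ltW/ln_sublinear.
    have : q / 2 * ln L <= 1 * ln L by rewrite ler_wpM2r.
    lra.
  have lk0 : 0 <= 1 + ln (M%:R / k%:R) :> R.
    rewrite addr_ge0// ln_ge0// ler_pdivlMr// mul1r ler_nat (leq_trans ka)// ltnW//.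
  have h1' : 1 + ln (M%:R / k%:R) <= 2 * L by move: lL lk; rewrite lmt /L; lra.
  apply: (@le_trans _ _ (5 * mt * (2 * L))); last lra.
  by apply: ler_pM => //; lra.
Qed.
End Rate.

(** * Rates over the classes *)

Lemma eval_designE {R : realType} n M (X : 'M[R]_(n, M)) (theta : 'rV[R]_M) :
  eval_design X (f_lin theta) = theta *m X^T.
Proof.
by apply/rowP => i; rewrite !mxE /f_lin; apply: eq_bigr => j _; rewrite !mxE.
Qed.

Section ClassRates.
Context {R : realType} {d : measure_display} {T : measurableType d} {P : probability T R}.
Context {n M : nat} (X : 'M[R]_(n, M)) (lambda sigma : R) (eps : 'I_n -> {RV P >-> R})
  (jhat : 'rV[R]_n -> model M).
Hypotheses (n0 : (0 < n)%N) (M2 : (2 <= M)%N) (hl : 51 / 10 * ln 2 <= lambda) (s0 : 0 < sigma)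
  (iid : iid_normal P eps sigma) (sel : abc_selector X lambda sigma jhat)
  (r0 : (1 <= rank_model X full_model)%N)
  (hX : forall j : 'I_M, (\sum_(i < n) X i j ^+ 2) / n%:R <= 1).
Let r := rank_model X full_model.
Let n0R : (0 : R) < n%:R. Proof. by rewrite ltr0n. Qed.
Let l0 : 0 <= lambda.
Proof. have := @ln2_lb R; move: hl; lra. Qed.

Let colX j : sqn (row j X^T) <= n%:R.
Proof.
rewrite sqnE; have := hX j; rewrite ler_pdivrMr// mul1r => /(le_trans _); apply.
by apply: ler_sum => i _; rewrite !mxE.
Qed.

Let up (c c' D : R) theta : (risk P X eps jhat (theta *m X^T) <= (c * lambda * D)%:E)%E ->
  0 <= D -> c <= c' -> (risk P X eps jhat (theta *m X^T) <= (c' * lambda * D)%:E)%E.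
Proof.
move=> /le_trans h D0 cc; apply: h; rewrite lee_fin.
by apply: (ler_wpM2r D0); exact: ler_wpM2r.
Qed.

Let rate_full0 : 0 <= rate_full n r sigma.
Proof. by rewrite /rate_full !mulr_ge0 ?sqr_ge0 ?invr_ge0// ltW. Qed.

Lemma risk_le_rate_full c theta : 440 <= c ->
  (risk P X eps jhat (theta *m X^T) <= (c * lambda * rate_full n r sigma)%:E)%E.
Proof.
move=> c440; apply: (up _ rate_full0 c440).
by apply: risk_le_range => //; exact: submxMl.
Qed.

Lemma risk_le_Phi_0 k (theta : 'rV[R]_M) : (1 <= k <= M)%N -> (norm0 theta <= k)%N ->
  (risk P X eps jhat (theta *m X^T) <= (1320 * lambda * Phi_0 n M r sigma k)%:E)%E.
Proof.
move=> kM tk; rewrite /Phi_0 minElt; case: ifP => _.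
  have := risk_le_sparse n0 M2 hl s0 iid sel (theta *m X^T) r0 kM tk.
  rewrite subrr dotp0l add0r => /le_trans; apply; rewrite lee_fin le_eqVlt; apply/orP; left.
  apply/eqP; ring.
by apply: risk_le_rate_full; lra.
Qed.

(** In the middle regime the approximant is 2k-sparse, with k from [rate_mid]; K
    truncates 2k at M.  In the last regime the intercept model is used: its bias
    is at most |mu|^2 <= n |theta|_1^2 <= n t^2. *)
Lemma risk_le_Phi_q (q t : R) (theta : 'rV[R]_M) : 0 < q <= 1 -> 0 < t -> Defs.normq q theta <= t ->
  (risk P X eps jhat (theta *m X^T) <= (21 * 1320 * lambda * Phi_q n M r sigma q t)%:E)%E.
Proof.
move=> /[dup] q01 /andP[q0 q1] t0 tq.
have full : (risk P X eps jhat (theta *m X^T) <=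
    (21 * 1320 * lambda * rate_full n r sigma)%:E)%E.
  by apply: risk_le_rate_full; lra.
rewrite /Phi_q; case: ifP => // _; case: ifP => [mid|_]; rewrite minElt; case: ifP => // _.
- have [L0 [k [/andP[k0 kM] hk1 hk2]]] := rate_mid n0 s0 q0 q1 t0 mid.
  rewrite rate_mid_eq//.
  set L := 1 + _ in L0 hk1 hk2 *; set E := eff_dim _ _ _ _ in L0 hk1 hk2 *.
  set D := E * _ in hk1 hk2 *.
  have [theta' t'0 t'e] := sparse_approx colX (ltW n0R) q01 t0 k0 tq.
  pose K := minn k.*2 M.
  have kK : (k <= K)%N by rewrite leq_min kM andbT -addnn leq_addr.
  have KM : (1 <= K <= M)%N by rewrite geq_minr andbT (leq_trans k0 kK).
  have t'K : (norm0 theta' <= K)%N.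
    by rewrite leq_min t'0 -[leqRHS]card_ord max_card.
  have := risk_le_sparse n0 M2 hl s0 iid sel (theta *m X^T) r0 KM t'K.
  rewrite -mulmxBl => /le_trans; apply; rewrite lee_fin [leRHS]mulrCA; apply: ler_wpM2l.
    by rewrite invr_ge0 ltW.
  have k0R : 0 < k%:R :> R by rewrite ltr0n.
  have kKR : k%:R <= K%:R :> R by rewrite ler_nat.
  have K2R : K%:R <= 2 * k%:R :> R by rewrite -natrM ler_nat mul2n geq_minl.
  have M0R : 0 < M%:R :> R by rewrite ltr0n (ltnW M2).
  have hK : K%:R * (1 + ln (M%:R / K%:R)) <= 2 * (10 * D).
    apply: (@le_trans _ _ (2 * (k%:R * (1 + ln (M%:R / k%:R))))); last by rewrite ler_pM2l.
    have KR0 : 0 < K%:R :> R by exact: lt_le_trans kKR.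
    have lk : ln (M%:R / K%:R) <= ln (M%:R / k%:R) :> R.
      by rewrite ler_ln ?posrE ?divr_gt0// ler_wpM2l ?(ltW M0R)// lef_pV2 ?posrE.
    have lK0 : 0 <= ln (M%:R / K%:R) :> R.
      by rewrite ln_ge0// ler_pdivlMr// mul1r ler_nat geq_minr.
    rewrite mulrA; apply: ler_pM => //; lra.
  have s20 : 0 <= sigma ^+ 2 by exact: sqr_ge0.
  have := ler_wpM2l s20 hK; set Kl := K%:R * _ => hK'.
  have : sqn ((theta - theta') *m X^T) + sigma ^+ 2 * Kl <= 21 * (sigma ^+ 2 * D).
    by move: hk1 t'e; rewrite mulrA; lra.
  have l1320 : 0 <= 1320 * lambda := mulr_ge0 (ler0n _ _) l0.
  move=> /(ler_wpM2l l1320); lra.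
- have h := risk_le_intercept n0 M2 hl s0 iid sel (theta *m X^T).
  apply: (le_trans h); rewrite lee_fin.
  have b : sqn (bias X (theta *m X^T) Intercept) <= t ^+ 2 * n%:R.
    have hQ := proj_mat_orthoproj X Intercept n0.
    apply: (@le_trans _ _ (sqn (theta *m X^T))).
      by rewrite [leRHS](orthoproj_pythagoras hQ) lerDl sqn_ge0.
    apply: le_trans (sqn_combo_le colX (erefl _)) _.
    rewrite ler_wpM2r// ?(ltW n0R)// lerXn2r ?nnegrE ?sumr_ge0 ?(ltW t0)//.
    exact: norm1_le_normq tq.
  set m := Num.max _ _.
  have m1 : t ^+ 2 * n%:R <= m * n%:R by rewrite ler_wpM2r ?(ltW n0R)// le_max lexx.
  have m2 : sigma ^+ 2 <= m * n%:R.
    by rewrite -ler_pdivrMr// le_max lexx orbT.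
  rewrite mulrC ler_pdivrMr//.
  have l440 : 0 <= 440 * lambda := mulr_ge0 (ler0n _ _) l0.
  apply: (@le_trans _ _ (440 * lambda * (2 * (m * n%:R)))).
    by apply: (ler_wpM2l l440); lra.
  have m0 : 0 <= lambda * (m * n%:R).
    by rewrite mulr_ge0// (le_trans _ m2)// sqr_ge0.
  lra.
Qed.
End ClassRates.

Theorem theorem7 (R : realType) :
  exists (Bq : R -> R -> R) (B0 : R -> R) (Bq0 : R -> R -> R) (B : R -> R),
  forall (lambda : R), 51 / 10 * ln 2 <= lambda ->
  forall (n M : nat) (X : 'M[R]_(n, M)) (sigma : R)
    (d : measure_display) (T : measurableType d) (P : probability T R)
    (eps : 'I_n -> {RV P >-> R}) (jhat : 'rV[R]_n -> model M),
  (2 <= n)%N -> (2 <= M)%N ->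
  (forall j : 'I_M, (\sum_(i < n) X i j ^+ 2) / n%:R <= 1) ->
  (1 <= rank_model X full_model)%N ->
  0 < sigma ->
  iid_normal P eps sigma ->
  abc_selector X lambda sigma jhat ->
  let r := rank_model X full_model in
  (forall q t : R, 0 < q <= 1 -> 0 < t ->
     (ereal_sup [set risk P X eps jhat (eval_design X f0) | f0 in Fq q t]
      <= (Bq q lambda * Phi_q n M r sigma q t)%:E)%E) /\
  (forall k : nat, (1 <= k <= M)%N ->
     (ereal_sup [set risk P X eps jhat (eval_design X f0) | f0 in F0 k]
      <= (B0 lambda * Phi_0 n M r sigma k)%:E)%E) /\
  (forall (q t : R) (k : nat), 0 < q <= 1 -> 0 < t -> (1 <= k <= M)%N ->
     (ereal_sup [set risk P X eps jhat (eval_design X f0)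
                | f0 in Fq q t `&` F0 k]
      <= (Bq0 q lambda * Phi_q0 n M r sigma q t k)%:E)%E) /\
  (forall f0n : 'rV[R]_n,
     (risk P X eps jhat f0n
      <= (Num.min
            (B lambda *
             (normn2 (proj_model X full_model f0n - f0n)
              + Num.min (oracle X sigma f0n) (sigma ^+ 2 * r%:R / n%:R)))
            (B lambda *
             Num.min (normn2 (proj_model X Intercept f0n - f0n)
                      + sigma ^+ 2 / n%:R)
                     (sigma ^+ 2)))%:E)%E).
Proof.
exists (fun _ lambda => 21 * 1320 * lambda), (fun lambda => 1320 * lambda),
  (fun _ lambda => 21 * 1320 * lambda), (fun lambda => 880 * lambda).
move=> lambda hl n M X sigma d T P eps jhat n2 M2 hX r0 s0 iid sel r.
have n0 : (0 < n)%N by exact: ltnW.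
have l0 : 0 <= lambda by have := @ln2_lb R; move: hl; lra.
have n0R : (0 : R) < n%:R by rewrite ltr0n.
have nI : 0 <= n%:R^-1 :> R by rewrite invr_ge0 ltW.
have isq : 0 < sigma ^+ 2 by rewrite exprn_gt0.
have boundq q t theta : 0 < q <= 1 -> 0 < t -> Defs.normq q theta <= t ->
  (risk P X eps jhat (eval_design X (f_lin theta)) <=
    (21 * 1320 * lambda * Phi_q n M r sigma q t)%:E)%E.
  by rewrite eval_designE; exact: risk_le_Phi_q.
have bound0 k theta : (1 <= k <= M)%N -> (norm0 theta <= k)%N ->
  (risk P X eps jhat (eval_design X (f_lin theta)) <=
    (1320 * lambda * Phi_0 n M r sigma k)%:E)%E.
  by rewrite eval_designE; exact: risk_le_Phi_0.
split; [|split; [|split]].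
- move=> q t q01 t0; apply: ge_ereal_sup => _ [_ [theta tq <-] <-].
  exact: boundq.
- move=> k kM; apply: ge_ereal_sup => _ [_ [theta tk <-] <-].
  exact: bound0.
- move=> q t k q01 t0 kM; apply: ge_ereal_sup => _ [f [[theta tq fE] [theta' tk fE']] <-].
  rewrite /Phi_q0 minElt; case: ifP => _.
    by rewrite -fE; exact: boundq.
  rewrite -fE'; apply: le_trans (bound0 k theta' kM tk) _.
  have kM1 : (k%:R : R) <= M%:R by rewrite ler_nat; case/andP: kM.
  have k0R : 0 < k%:R :> R by rewrite ltr0n; case/andP: kM.
  have Phi0 : 0 <= Phi_0 n M r sigma k.
    have ln0 : 0 <= ln (M%:R / k%:R) :> R by rewrite ln_ge0// ler_pdivlMr// mul1r.
    rewrite /Phi_0 /rate_full le_min; apply/andP; split; last first.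
      by apply: mulr_ge0 => //; apply: mulr_ge0 => //; exact: ltW.
    apply: mulr_ge0 => //; apply: mulr_ge0; last by rewrite addr_ge0.
    by apply: mulr_ge0; exact: ltW.
  rewrite lee_fin; apply: (ler_wpM2r Phi0); apply: (ler_wpM2r l0); lra.
- move=> mu; set Rk := risk _ _ _ _ _.
  have nbE J : normn2 (proj_model X J mu - mu) = n%:R^-1 * sqn (bias X mu J).
    by rewrite normn2E proj_modelE /bias -opprB dotpNl dotpNr opprK.
  have p1 J : 0 <= lambda * (n%:R^-1 * sqn (bias X mu J)).
    by apply: mulr_ge0 => //; apply: mulr_ge0 => //; exact: sqn_ge0.
  have p2 : 0 <= lambda * (sigma ^+ 2) by apply: mulr_ge0 => //; exact: ltW.
  have p3 : 0 <= lambda * (sigma ^+ 2 / n%:R).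
    by apply: mulr_ge0 => //; apply: mulr_ge0 => //; exact: ltW.
  rewrite minElt; case: ifP => _; last first.
    rewrite minElt; case: ifP => _.
      apply: le_trans (risk_le_intercept n0 M2 hl s0 iid sel mu) _.
      rewrite lee_fin nbE; have := p1 Intercept; move: p3; lra.
    apply: le_trans (risk_le_saturated n0 M2 hl s0 iid sel mu) _.
    rewrite lee_fin; move: p2; lra.
  rewrite minElt; case: ifP => _; last first.
    apply: le_trans (risk_le_full n0 M2 hl s0 iid sel mu r0) _.
    have p4 : 0 <= lambda * (sigma ^+ 2 * r%:R / n%:R).
      by apply: mulr_ge0 => //; apply: mulr_ge0 => //; apply: mulr_ge0 => //; exact: ltW.
    rewrite lee_fin nbE -/r; have := p1 full_model; move: p4; lra.
  rewrite nbE; set b := n%:R^-1 * _.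
  have c0 : 0 < 880 * lambda.
    have l3 : 0 < lambda by have := @ln2_lb R; move: hl; lra.
    by move: l3; lra.
  have each (J : {set 'I_M}) : (1 <= #|J| < M)%N -> (Rk <= (880 * lambda * (b +
     (normn2 (proj_model X (Subset J) mu - proj_model X full_model mu)
           + sigma ^+ 2 * (rank_model X (Subset J))%:R / n%:R
           + sigma ^+ 2 * ln (minn M n)%:R / n%:R
           + sigma ^+ 2 * ln 'C(M, #|J|)%:R / n%:R)))%:E)%E.
    move=> hJ; have := risk_le_any_subset n0 M2 hl s0 iid sel mu r0 hJ.
    move=> /le_trans; apply; rewrite lee_fin le_eqVlt; apply/orP; left; apply/eqP.
    by rewrite normn2E !proj_modelE /b; ring.
  rewrite /oracle; set S := [set _ | _ in _].
  have Sne : S !=set0.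
    have i0 : 'I_M := Ordinal (ltnW M2).
    eexists; exists [set i0]%SET; last reflexivity.
    by rewrite /= cards1.
  have : forall s, S s -> (Rk <= (880 * lambda * (b + s))%:E)%E.
    by move=> _ [J hJ <-]; exact: each.
  case: Rk {each} => [x| |] H; last by rewrite leNye.
    rewrite lee_fin mulrC -ler_pdivrMr// -lerBlDl; apply: lb_le_inf => // s /H.
    by rewrite lee_fin mulrC -ler_pdivrMr// -lerBlDl.
  by case: Sne => s /H; rewrite leye_eq.
Qed.
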